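(* Let $\{Z_n\}_{n\in\mathbb{N}_0}$ be a defective Galton-Watson process in a varying environment $v=\{f_n\}_{n\in\mathbb{N}}$. Assume that there exists $c>0$ such that for all $n\in\mathbb{N}$, $$E[X_{n1}^2;X_{n1}\geq 2]\leq c\, E[X_{n1};X_{n1}\geq 2]\,E[X_{n1}\mid X_{n1}\geq 1].$$ Then $$P[\tau_a=\infty]>0\quad\Longleftrightarrow\quad \inf_{n\in\mathbb{N}} \mu_n >0,\quad \sum_{n=1}^\infty \delta_n \mu_{n-1} < \infty \quad\text{and}\quad \sum_{n=1}^\infty \frac{f_n''(1)}{f_n'(1)\mu_{n}}<\infty .$$
   Context: $\mathbb{N}=\{1,2,\dots\}$, $\mathbb{N}_0=\mathbb{N}\cup\{0\}$, $\Delta\notin\mathbb{N}_0$ is an extra ''graveyard'' state, and $\mathbb{N}_\Delta=\mathbb{N}_0\cup\{\Delta\}$. For each $n\in\mathbb{N}$, $f_n$ is a possibly defective distribution on $\mathbb{N}_0$: weights $f_n[k]\ge 0$, $k\in\mathbb{N}_0$, with $\sum_k f_n[k]\le 1$; its generating function is also denoted $f_n(s)=\sum_{k\ge0}f_n[k]s^k$, $s\in[0,1]$; $f_n'(1)=\sum_k kf_n[k]$, $f_n''(1)=\sum_k k(k-1)f_n[k]$. Standing assumption: $0<f_n'(1)<\infty$ for all $n\ge1$. A defective Galton-Watson process in a varying environment $v=\{f_n\}_{n\in\mathbb{N}}$ is the process defined by $Z_0=1$, $Z_n=\sum_{j=1}^{Z_{n-1}}X_{nj}$, $n\in\mathbb{N}$,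 where $\{X_{nj}:n,j\in\mathbb{N}\}$ are independent $\mathbb{N}_\Delta$-valued random variables with $P[X_{nj}=k]=f_n[k]$ for $k\in\mathbb{N}_0$ and $P[X_{nj}=\Delta]=1-f_n(1)$. Conventions: $\Delta+k=\Delta$ for $k\in\mathbb{N}_\Delta$, and $\sum_{j=1}^{\Delta}k_j=\Delta$; empty sums are $0$. Thus $0$ and $\Delta$ are absorbing. For an $\mathbb{N}_\Delta$-valued $X$, $E[h(X)]$ means $E[h(X);X\ne\Delta]$, and events such as $\{X\ge1\}$, $\{X\ge 2\}$ do not include $X=\Delta$. Notation: $\delta_n=1-f_n(1)$; $\mu_0=1$, $\mu_n=\prod_{i=1}^n f_i'(1)$; $\tau_0=\min\{n\in\mathbb{N}:Z_n=0\}$, $\tau_\Delta=\min\{n\in\mathbb{N}:Z_n=\Delta\}$ (with $\min\varnothing=\infty$), $\tau_a=\tau_0\wedge\tau_\Delta$. *)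

(* Defs.v *)
From HB Require Import structures.
From mathcomp Require Import all_boot all_order all_algebra.
From mathcomp Require Import all_classical all_reals all_analysis.

Set Implicit Arguments.
Unset Strict Implicit.
Unset Printing Implicit Defensive.

Import Order.TTheory GRing.Theory Num.Theory.

Local Open Scope classical_set_scope.
Local Open Scope ring_scope.
Local Open Scope ereal_scope.

(** The state space: [None] is the graveyard state Delta. It is countable and
    carries the discrete sigma-algebra. *)
Definition Ndelta : Type := option nat.

HB.instance Definition _ := Choice.on Ndelta.
HB.instance Definition _ := Pointed.on Ndelta.
HB.instance Definition _ := @isMeasurable.Build default_measure_display
  Ndelta discrete_measurable discrete_measurable0
  discrete_measurableC discrete_measurableU.

Definition Delta : Ndelta := None.
Definition state (k : nat) : Ndelta := Some k.

Definition addD (x y : Ndelta) : Ndelta :=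
  match x, y with
  | Some k, Some l => Some (k + l)%N
  | _, _ => None
  end.

Section environment.
Context {R : realType}.

(** The weights may sum to less than one, so the generating function and the
    factorial moments are extended-real series, and [fact_moment1 g] and
    [fact_moment2 g] stand for g'(1) and g''(1). *)
Definition genfun (g : nat -> R) (s : R) : \bar R :=
  \sum_(0 <= k <oo) (g k * s ^+ k)%:E.

Definition fact_moment1 (g : nat -> R) : \bar R :=
  \sum_(0 <= k <oo) (k%:R * g k)%:E.

Definition fact_moment2 (g : nat -> R) : \bar R :=
  \sum_(0 <= k <oo) (k%:R * (k%:R - 1) * g k)%:E.

Definition defective_distribution (g : nat -> R) : Prop :=
  (forall k, 0 <= g k)%R /\ \sum_(0 <= k <oo) (g k)%:E <= 1.

(** Generations are numbered from 1; [f 0] is never used. *)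
Definition varying_environment (f : nat -> nat -> R) : Prop :=
  forall n, (0 < n)%N ->
    defective_distribution (f n) /\ 0 < fact_moment1 (f n) < +oo.

Definition defect (f : nat -> nat -> R) (n : nat) : \bar R :=
  1 - genfun (f n) 1%R.

Definition mu (f : nat -> nat -> R) (n : nat) : \bar R :=
  \prod_(1 <= i < n.+1) fact_moment1 (f i).

End environment.

Section random_variables.
Context {d : measure_display} {Omega : measurableType d} {R : realType}.
Variable P : probability Omega R.

Definition mutually_independent {d'} {T : measurableType d'} {I : choiceType}
    (J : set I) (X : I -> Omega -> T) : Prop :=
  forall (s : seq I) (B : I -> set T),
    uniq s -> [set` s] `<=` J ->
    (forall i, i \in s -> measurable (B i)) ->
    P (\bigcap_(i in [set` s]) (X i @^-1` B i))
      = \prod_(i <- s) P (X i @^-1` B i).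

(** [event_in Y A] is {Y \in A} for A a set of natural numbers, so it never
    contains an outcome with Y = Delta. *)
Definition event_in (Y : Omega -> Ndelta) (A : set nat) : set Omega :=
  [set w | exists2 k, A k & Y w = state k].

(** E[h(Y); Y \in A]; the default value of [odflt] is irrelevant as Delta is
    excluded from the domain of integration. *)
Definition expect_on (Y : Omega -> Ndelta) (h : nat -> R) (A : set nat)
    : \bar R :=
  \int[P]_(w in event_in Y A) (h (odflt 0%N (Y w)))%:E.

(** E[h(Y) | Y \in A] *)
Definition cond_expect (Y : Omega -> Ndelta) (h : nat -> R) (A : set nat)
    : \bar R :=
  expect_on Y h A / P (event_in Y A).

(** Only the variables [X n j] with n, j >= 1 matter. *)
Definition offspring_array (f : nat -> nat -> R)
    (X : nat -> nat -> {RV P >-> Ndelta}) : Prop :=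
  [/\ mutually_independent [set i : nat * nat | (0 < i.1)%N /\ (0 < i.2)%N]
        (fun i => X i.1 i.2 : Omega -> Ndelta),
      forall n j k, (0 < n)%N -> (0 < j)%N ->
        P (X n j @^-1` [set state k]) = (f n k)%:E
    & forall n j, (0 < n)%N -> (0 < j)%N ->
        P (X n j @^-1` [set Delta]) = 1 - genfun (f n) 1%R].

End random_variables.

Section process.
Context {Omega : Type}.

Fixpoint GW (X : nat -> nat -> Omega -> Ndelta) (n : nat) (w : Omega)
    : Ndelta :=
  if n is m.+1 then
    if GW X m w is Some z
    then \big[addD/state 0]_(1 <= j < z.+1) X m.+1 j w
    else Delta
  else state 1.

Context {R : realType}.

(** min {n >= 1 : Z_n = x} for the process Z, with value +oo when the set is
    empty ([ereal_inf set0 = +oo]). *)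
Definition hitting_time (Z : nat -> Omega -> Ndelta) (x : Ndelta) (w : Omega)
    : \bar R :=
  ereal_inf [set n%:R%:E | n in [set n | (0 < n)%N /\ Z n w = x]].

Definition absorption_time (Z : nat -> Omega -> Ndelta) (w : Omega) : \bar R :=
  Order.min (hitting_time Z (state 0) w) (hitting_time Z Delta w).

End process.

(* Main.v *)
(** Write G_n for the generating function of f_n, so that
    P[Z_n >= 1] = G_1 o ... o G_n (1) - G_1 o ... o G_n (0), and put
    rho_n = f_n''(1) / (f_n'(1) mu_n).

    For one generation and 0 <= v <= u <= 1, d = u - v,
      1 / (G u - G v) >= 1 / (f'(1) d) + kappa f''(1) / f'(1)^2   and
      1 / (G 1 - G v) <= 1 / (f'(1) (1 - v)) + f''(1) / f'(1)^2;
    the first one is Jensen's inequality for a concave function of the number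
    of children and is where the moment assumption enters.  Composing the
    generations k+1, ..., n these give, for one particle of generation k, with
    w, x and y its probabilities to have living descendants at time n, to be
    killed before n, and not to be extinct at n,
      1 / (mu_k w) >= 1 / mu_n + kappa (rho_(k+1) + ... + rho_n),
      1 / (mu_k y) <= 1 / mu_n + rho_(k+1) + ... + rho_n,
      mu_k x <= A,   1 / (mu_k x) <= 1 / A + rho_(k+1) + ... + rho_n,
    where A is the sum of delta_j mu_(j-1) over k < j <= n.

    If the three conditions hold, then w = y - x is positive for k large,
    uniformly in n.  If the process survives, the bound on w gives the first
    and the third condition.  If moreover A were unbounded, then w <= C x with a
    constant C for every k and all n large enough; by convexity
    P[Z_n >= 1] <= C P[killed between k and n], which is arbitrarily small. *)

Require Import Defs.
From HB Require Import structures.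
From mathcomp Require Import all_boot all_order all_algebra.
From mathcomp Require Import all_classical all_reals all_analysis.
From mathcomp Require Import measurable_realfun ring lra.

Set Implicit Arguments.
Unset Strict Implicit.
Unset Printing Implicit Defensive.

Import numFieldNormedType.Exports.
Import Order.TTheory GRing.Theory Num.Theory.
Local Open Scope classical_set_scope.
Local Open Scope ring_scope.

(** * Compositions of generating functions *)

Section composition.
Context {R : realType}.
Implicit Types (F G : R -> R) (u v t : R).

Definition unit_interval_map G :=
  forall u, 0 <= u <= 1 -> 0 <= G u <= 1.

Definition nondecreasing01 G :=
  forall v u, 0 <= v -> v <= u -> u <= 1 -> G v <= G u.

(** Comparison of the slopes on [v, u] and [u, t], multiplied out so that degenerate intervals are
    allowed. *)
Definition convex01 G := forall v u t, 0 <= v -> v <= u -> u <= t -> t <= 1 ->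
  (t - u) * (G u - G v) <= (G t - G u) * (u - v).

(** A uniform strict monotonicity. It carries a lower bound for a particle of a fixed generation
    back to the first particle. *)
Definition separating01 G := forall q, 0 < q -> exists2 q', 0 < q' &
  forall v u, 0 <= v -> u <= 1 -> q <= u - v -> q' <= G u - G v.

Lemma nondecreasing01_comp F G : unit_interval_map G ->
  nondecreasing01 F -> nondecreasing01 G -> nondecreasing01 (F \o G).
Proof.
move=> G01 hF hG v u v0 vu u1 /=.
have /andP[Gv0 _] : 0 <= G v <= 1 by apply: G01; lra.
have /andP[_ Gu1] : 0 <= G u <= 1 by apply: G01; lra.
by apply: hF => //; exact: hG.
Qed.

(** The slope inequality of [F] at G v, G u, G t is chained with that of [G] at v, u, t, and the
    common factor G t - G u is cancelled. *)
Lemma convex01_comp F G : unit_interval_map G -> nondecreasing01 G ->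
  nondecreasing01 F -> convex01 F -> convex01 G -> convex01 (F \o G).
Proof.
move=> G01 hG hF cF cG v u t v0 vu ut t1 /=.
have /andP[Gv0 _] : 0 <= G v <= 1 by apply: G01; lra.
have /andP[_ Gt1] : 0 <= G t <= 1 by apply: G01; lra.
have Gvu : G v <= G u by apply: hG => //; lra.
have Gut : G u <= G t by apply: hG => //; lra.
have Fvu : F (G v) <= F (G u) by apply: hF => //; lra.
have Fut : F (G u) <= F (G t) by apply: hF => //; lra.
have := cF _ _ _ Gv0 Gvu Gut Gt1.
have := cG _ _ _ v0 vu ut t1.
move: Gvu; rewrite le_eqVlt => /orP[/eqP -> _ _|Gvu].
  by rewrite subrr mulr0 mulr_ge0 ?subr_ge0.
move: ut; rewrite le_eqVlt => /orP[/eqP -> _ _|ut].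
  by rewrite !subrr !mul0r.
move: (F (G v)) (F (G u)) (F (G t)) Fvu Fut => p q r pq qr.
move: (G v) (G u) (G t) Gvu Gut {Gv0 Gt1} => x y z xy yz h1 h2.
(* If [z = y], the inequality for [G] would give [(t - u) * (y - x) <= 0]. *)
have zy : 0 < z - y.
  rewrite lt_neqAle subr_ge0 yz andbT eq_sym; apply/eqP => zy0.
  have := mulr_gt0 (_ : 0 < t - u) (_ : 0 < y - x).
  by rewrite !subr_gt0 => /(_ ut xy); rewrite ltNge (le_trans h1)// zy0 mul0r.
suff : (t - u) * (q - p) * (z - y) <= (r - q) * (u - v) * (z - y).
  by rewrite ler_pM2r.
apply: (@le_trans _ _ ((r - q) * ((t - u) * (y - x)))).
  have -> : (t - u) * (q - p) * (z - y) = (t - u) * ((z - y) * (q - p)) by ring.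
  have -> : (r - q) * ((t - u) * (y - x)) = (t - u) * ((r - q) * (y - x)) by ring.
  by rewrite ler_wpM2l// subr_ge0 ltW.
have -> : (r - q) * (u - v) * (z - y) = (r - q) * ((z - y) * (u - v)) by ring.
by rewrite ler_wpM2l// subr_ge0.
Qed.

Lemma separating01_comp F G : unit_interval_map G -> nondecreasing01 G ->
  separating01 F -> separating01 G -> separating01 (F \o G).
Proof.
move=> G01 hG sF sG q q0; have [q1 /sF[q2 q20 hq2] hq1] := sG q q0.
exists q2 => //.
move=> v u v0 u1 quv /=; apply: hq2; last exact: hq1.
  by have /andP[] : 0 <= G v <= 1 by apply: G01; lra.
by have /andP[] : 0 <= G u <= 1 by apply: G01; lra.
Qed.

End composition.

(* [m] and [b] stand for G'(1) and G''(1). *)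
Record offspring_map {R : realType} (kappa : R) (G : R -> R) (m b : R) : Prop :=
  OffspringMap {
  om_unit : unit_interval_map G;
  om_nondecreasing : nondecreasing01 G;
  om_convex : convex01 G;
  om_separating : separating01 G;
  om_mean_gt0 : 0 < m;
  om_fact2_ge0 : 0 <= b;
  om_lipschitz : forall v u : R, 0 <= v -> v <= u -> u <= 1 ->
    G u - G v <= m * (u - v);
  (* This and [om_lower] are the two bounds on reciprocals with denominators cleared. *)
  om_upper : forall v u : R, 0 <= v -> v <= u -> u <= 1 ->
    (G u - G v) * (1 + kappa * (b / m) * (u - v)) <= m * (u - v);
  om_lower : forall v : R, 0 <= v -> v <= 1 ->
    m * (1 - v) <= (G 1 - G v) * (1 + b / m * (1 - v)) }.

(** Replaces passage to a limit: beyond such an index a bounded nondecreasing sequence gains at most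
    [eta]. *)
Lemma almost_sup {R : realType} (u : nat -> R) (C eta : R) :
  (forall n, u n <= C) -> 0 < eta -> exists k, forall n, u n <= u k + eta.
Proof.
move=> uC eta0.
have hs : has_sup (range u).
  by split; [exists (u 0%N), 0%N | exists C => _ [n _ <-]].
have [_ [k _ <-] hk] := sup_adherent eta0 hs.
exists k => n.
have : u n <= sup (range u) by apply: sup_upper_bound => //; exists n.
by lra.
Qed.

(** * Survival and killing probabilities across several generations *)

Section iteration.
Context {R : realType}.
Variables (G : nat -> R -> R) (m b : nat -> R) (kappa : R).
Implicit Types (k l n : nat).

(* [iterG k l] is G_(k+1) o ... o G_(k+l). *)
Fixpoint iterG k l (s : R) : R :=
  if l is l'.+1 then G k.+1 (iterG k.+1 l' s) else s.

Lemma iterG_add k l l' s : iterG k (l + l') s = iterG k l (iterG (k + l) l' s).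
Proof.
elim: l k => [k|l IH k]; first by rewrite addn0.
by rewrite addSn /= IH addSnnS.
Qed.

Lemma iterG_last n s : iterG 0 n.+1 s = iterG 0 n (G n.+1 s).
Proof. by have := iterG_add 0 n 1 s; rewrite addn1 add0n. Qed.

Definition meanprod n := \prod_(1 <= i < n.+1) m i.

Definition rho n := b n / (m n * meanprod n).

(** Since G_n(1) = 1 - delta_n, this is delta_n mu_(n-1) for n >= 1. *)
Definition killing n := (1 - G n 1) * meanprod n.-1.

(** Parametrised by start and length, like [iterG], so that an induction on the length can split off
    the first generation. *)
Definition window (a : nat -> R) k l := \sum_(k.+1 <= j < (k + l).+1) a j.

Lemma window0 a k : window a k 0 = 0.
Proof. by rewrite /window addn0 big_geq. Qed.

Lemma windowS a k l : window a k l.+1 = a k.+1 + window a k.+1 l.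
Proof.
by rewrite /window big_ltn ?ltnS ?addnS ?ltnS ?leq_addr// addSn.
Qed.

Lemma window_cat a k l l' :
  window a k (l + l') = window a k l + window a (k + l) l'.
Proof. by rewrite /window addnA (big_cat_nat (n := (k + l).+1)) ?ltnS ?leq_addr. Qed.

Lemma window_ge0 a k l : (forall n, 0 <= a n.+1) -> 0 <= window a k l.
Proof.
move=> a0; rewrite /window big_nat_cond sumr_ge0// => -[|i]//; by rewrite andbT.
Qed.

Hypothesis kappa_gt0 : 0 < kappa.
Hypothesis hG : forall k, offspring_map kappa (G k.+1) (m k.+1) (b k.+1).

Let G01 k : unit_interval_map (G k.+1). Proof. by case: (hG k). Qed.
Let Gnd k : nondecreasing01 (G k.+1). Proof. by case: (hG k). Qed.
Let Gcvx k : convex01 (G k.+1). Proof. by case: (hG k). Qed.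
Let Gsep k : separating01 (G k.+1). Proof. by case: (hG k). Qed.
Let m_gt0 k : 0 < m k.+1. Proof. by case: (hG k). Qed.
Let b_ge0 k : 0 <= b k.+1. Proof. by case: (hG k). Qed.

Lemma iterG01 k l : unit_interval_map (iterG k l).
Proof. by elim: l k => [|l IH] k u u01 //=; apply: G01; exact: IH. Qed.

Lemma iterG_nd k l : nondecreasing01 (iterG k l).
Proof.
elim: l k => [|l IH] k; first by move=> v u.
apply: (nondecreasing01_comp (iterG01 k.+1 l) (Gnd k) (IH k.+1)).
Qed.

Lemma iterG_cvx k l : convex01 (iterG k l).
Proof.
elim: l k => [|l IH] k; first by move=> v u t *; rewrite mulrC.
apply: (convex01_comp (iterG01 k.+1 l) (iterG_nd k.+1 l) (Gnd k) (Gcvx k) (IH k.+1)).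
Qed.

Lemma iterG_sep k l : separating01 (iterG k l).
Proof.
elim: l k => [|l IH] k; first by move=> q q0; exists q.
apply: (separating01_comp (iterG01 k.+1 l) (iterG_nd k.+1 l) (Gsep k) (IH k.+1)).
Qed.

Lemma meanprod0 : meanprod 0 = 1.
Proof. by rewrite /meanprod big_geq. Qed.

Lemma meanprodS n : meanprod n.+1 = meanprod n * m n.+1.
Proof. by rewrite /meanprod big_nat_recr. Qed.

Lemma meanprod_gt0 n : 0 < meanprod n.
Proof. by elim: n => [|n IH]; rewrite ?meanprod0// meanprodS mulr_gt0. Qed.

Lemma rho_ge0 n : 0 <= rho n.+1.
Proof. by rewrite divr_ge0// mulr_ge0// ltW// meanprod_gt0. Qed.

Lemma killing_ge0 n : 0 <= killing n.+1.
Proof.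
rewrite mulr_ge0//; last exact/ltW/meanprod_gt0.
by have /andP[] : 0 <= G n.+1 1 <= 1; [apply: G01|]; lra.
Qed.

(** A generating function gives at 1 the probability of not being killed and at 0 that of
    extinction. So these are the probabilities w, x and y for one particle of generation [k]
    observed at time [k + l]; killed lines count as not extinct. *)
Definition alive k l := iterG k l 1 - iterG k l 0.
Definition killed k l := 1 - iterG k l 1.
Definition nonextinct k l := 1 - iterG k l 0.

Lemma iterG01_0 k l : 0 <= iterG k l 0 <= 1.
Proof. by apply: iterG01; rewrite lexx ler01. Qed.

Lemma iterG01_1 k l : 0 <= iterG k l 1 <= 1.
Proof. by apply: iterG01; rewrite lexx ler01. Qed.

Lemma alive_ge0 k l : 0 <= alive k l.
Proof. by rewrite subr_ge0 iterG_nd. Qed.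

Lemma alive_le1 k l : alive k l <= 1.
Proof. by have := iterG01_0 k l; have := iterG01_1 k l; rewrite /alive; lra. Qed.

(** Induction on [l]: passing through generation k+1, [om_upper] adds [kappa * rho k.+1] to the
    bound on the reciprocal. The product form also covers [alive k l = 0]. *)
Lemma alive_upper k l : meanprod k * alive k l *
  ((meanprod (k + l))^-1 + kappa * window rho k l) <= 1.
Proof.
elim: l k => [|l IH] k.
  rewrite window0 addn0 /alive /= mulr0 addr0 subr0 mulr1.
  by rewrite divff// gt_eqF ?meanprod_gt0.
rewrite windowS addnS -addSn.
move: (IH k.+1); set Q := _ + kappa * _ => hQ.
have Q0 : 0 <= Q.
  rewrite addr_ge0 ?invr_ge0 ?(ltW (meanprod_gt0 _))// mulr_ge0 ?(ltW kappa_gt0)//.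
  exact/window_ge0/rho_ge0.
have -> : (meanprod (k.+1 + l))^-1 + kappa * (rho k.+1 + window rho k.+1 l) =
  Q + kappa * rho k.+1 by rewrite /Q; ring.
have /andP[v0 v1] := iterG01_0 k.+1 l.
have /andP[u0 u1] := iterG01_1 k.+1 l.
have vu : iterG k.+1 l 0 <= iterG k.+1 l 1 by rewrite iterG_nd.
have := om_upper (hG k) v0 vu u1.
rewrite -[_ - G _ _]/(alive k l.+1) -/(alive k.+1 l).
rewrite meanprodS in hQ.
rewrite /rho meanprodS.
move: (alive_ge0 k.+1 l) (alive_ge0 k l.+1) (meanprod_gt0 k) (m_gt0 k) (b_ge0 k) hQ.
move: (alive k.+1 l) (alive k l.+1) (meanprod k) (m _) (b _) => w w' M mm bb.
move=> w0 w'0 M0 mm0 bb0 hQ hw.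
(* The argument divides by [w]; if [w = 0], then [hw] forces [w' = 0]. *)
have [w_eq0|w_neq0] := eqVneq w 0.
  have -> : w' = 0.
    by apply/le_anti; rewrite w'0 andbT; move: hw; rewrite w_eq0 !mulr0 addr0 mulr1.
  by rewrite mulr0 mul0r ler01.
have {}w0 : 0 < w by rewrite lt_neqAle eq_sym w_neq0.
have hQ' : Q <= (M * mm * w)^-1.
  have h : 0 < M * mm * w by rewrite !mulr_gt0.
  by rewrite -(ler_pM2l h) divff ?gt_eqF.
apply: (@le_trans _ _ (M * w' * ((M * mm * w)^-1 + kappa * (bb / (mm * (M * mm)))))).
  by rewrite ler_wpM2l ?lerD2r// mulr_ge0// ltW.
have -> : M * w' * ((M * mm * w)^-1 + kappa * (bb / (mm * (M * mm)))) =
   w' * (1 + kappa * (bb / mm) * w) / (mm * w).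
  by field; rewrite !gt_eqF.
by rewrite ler_pdivrMr ?mulr_gt0// mul1r.
Qed.

(** In terms of reciprocals: 1/y <= q and 1/e <= 1/y + r give 1/e <= q + r. *)
Lemma harmonic_step (y e r q : R) : 0 <= r -> 0 < y -> 1 <= y * q ->
  y <= e * (1 + r * y) -> 1 <= e * (q + r).
Proof.
move=> r0 y0 yq ye.
have ry0 : 0 < 1 + r * y by rewrite ltr_wpDr// mulr_ge0// ltW.
have e0 : 0 < e.
  by rewrite -(pmulr_lgt0 _ ry0); apply: lt_le_trans ye.
rewrite -(ler_pM2l y0) mulr1 (le_trans ye)//.
have -> : y * (e * (q + r)) = e * (y * q + r * y) by ring.
by rewrite ler_wpM2l ?lerD2r// ltW.
Qed.

(** [om_lower] with each generation scaled by its own mean, which is the shape that [harmonic_step]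
    takes. *)
Lemma G_lower_scaled k (v : R) : 0 <= v -> v <= 1 ->
  meanprod k.+1 * (1 - v) <= meanprod k * (G k.+1 1 - G k.+1 v) *
    (1 + rho k.+1 * (meanprod k.+1 * (1 - v))).
Proof.
move=> v0 v1; have := om_lower (hG k) v0 v1.
move=> h; rewrite /rho meanprodS.
have -> : b k.+1 / (m k.+1 * (meanprod k * m k.+1)) * (meanprod k * m k.+1 * (1 - v))
   = b k.+1 / m k.+1 * (1 - v).
  by field; rewrite !gt_eqF// meanprod_gt0.
by rewrite -!mulrA in h *; rewrite ler_wpM2l// ltW// meanprod_gt0.
Qed.

Lemma nonextinct_lower k l :
  1 <= meanprod k * nonextinct k l * ((meanprod (k + l))^-1 + window rho k l).
Proof.
elim: l k => [|l IH] k.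
  rewrite window0 addn0 /nonextinct /= addr0 subr0 mulr1.
  by rewrite divff// gt_eqF ?meanprod_gt0.
rewrite windowS addnS -addSn.
have -> : (meanprod (k.+1 + l))^-1 + (rho k.+1 + window rho k.+1 l) =
  ((meanprod (k.+1 + l))^-1 + window rho k.+1 l) + rho k.+1 by ring.
have /andP[v0 v1] := iterG01_0 k.+1 l.
have y0 : 0 < meanprod k.+1 * nonextinct k.+1 l.
  rewrite lt_neqAle mulr_ge0 ?(ltW (meanprod_gt0 _)) ?subr_ge0// andbT.
  by apply/eqP => y0; have := IH k.+1; rewrite -y0 mul0r leNgt ltr01.
apply: (harmonic_step (rho_ge0 k) y0 (IH _)).
apply: (le_trans (G_lower_scaled k v0 v1)).
rewrite ler_wpM2r//.
  rewrite addr_ge0// mulr_ge0 ?rho_ge0//.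
  by rewrite mulr_ge0 ?subr_ge0 ?(ltW (meanprod_gt0 _)).
(* Being killed in generation k+1 counts as not being extinct, so [G k.+1 1] may be replaced by
   1. *)
rewrite ler_wpM2l ?(ltW (meanprod_gt0 _))// /nonextinct /=.
have /andP[_] : 0 <= G k.+1 1 <= 1 by apply: G01; rewrite ler01 lexx.
by lra.
Qed.

(** A first-moment bound: killing happens in generation k+1, which contributes [killing k.+1], or
    later, where [om_lipschitz] brings in the mean number of children. *)
Lemma killed_upper k l : meanprod k * killed k l <= window killing k l.
Proof.
elim: l k => [|l IH] k; first by rewrite window0 /killed /= subrr mulr0.
rewrite windowS {1}/killing {1}/killed /=.
have /andP[v0 v1] := iterG01_1 k.+1 l.
have := om_lipschitz (hG k) v0 v1 (lexx 1) => h.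
have : meanprod k * (G k.+1 1 - G k.+1 (iterG k.+1 l 1)) <=
    meanprod k * (m k.+1 * killed k.+1 l).
  by rewrite ler_wpM2l// ltW// meanprod_gt0.
by have := IH k.+1; rewrite meanprodS /killed; lra.
Qed.

(** This is 1 / (mu_k x) <= 1 / A + the sum of [rho], multiplied out so that A = 0 is allowed. *)
Lemma killed_lower k l : window killing k l <=
  meanprod k * killed k l * (1 + window rho k l * window killing k l).
Proof.
elim: l k => [|l IH] k; first by rewrite !window0 /killed /= subrr !mulr0 mul0r.
have A0 := window_ge0 k.+1 l killing_ge0; have R0 := window_ge0 k.+1 l rho_ge0.
rewrite !windowS.
have r0 := rho_ge0 k; have a0 := killing_ge0 k.
have /andP[v0 v1] := iterG01_1 k.+1 l.
have hl := G_lower_scaled k v0 v1.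
set e := meanprod k * (G k.+1 1 - G k.+1 (iterG k.+1 l 1)) in hl.
have -> : meanprod k * killed k l.+1 = killing k.+1 + e.
  by rewrite /killed /= /killing /e; ring.
have e0 : 0 <= e.
  rewrite /e mulr_ge0 ?(ltW (meanprod_gt0 _))// subr_ge0.
  by apply: Gnd => //; lra.
have Rr0 : 0 <= rho k.+1 + window rho k.+1 l by rewrite addr_ge0.
have [A_eq0|A_neq0] := eqVneq (window killing k.+1 l) 0.
  rewrite A_eq0 addr0 -[leLHS]mulr1.
  by rewrite ler_pM ?ler01// ?lerDl// mulr_ge0.
have {}A0 : 0 < window killing k.+1 l by rewrite lt_neqAle eq_sym A_neq0.
have y0 : 0 < meanprod k.+1 * killed k.+1 l.
  rewrite lt_neqAle mulr_ge0 ?(ltW (meanprod_gt0 _)) ?subr_ge0// andbT.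
  apply/eqP => y0; have := IH k.+1.
  by rewrite -y0 mul0r leNgt A0.
have q1 : 1 <= meanprod k.+1 * killed k.+1 l *
    ((window killing k.+1 l)^-1 + window rho k.+1 l).
  rewrite -(ler_pM2r A0) mul1r (le_trans (IH k.+1))//.
  by rewrite le_eqVlt; apply/orP; left; apply/eqP; field.
have := harmonic_step r0 y0 q1 hl.
move: A0 R0 r0 a0 e0 Rr0; clear.
move: (window killing k.+1 l) (window rho k.+1 l) (rho k.+1) (killing k.+1).
move=> A W r a A0 W0 r0 a0 e0 Wr0 h.
(* Immediate killing [a] and later killing [e] are bounded separately; enlarging both factors to
   [1 + (r + W) * (a + A)] lets the two bounds be added. *)
have h1 : A <= e * (1 + (r + W) * A).
  rewrite -[leLHS]mul1r (le_trans (ler_wpM2r (ltW A0) h))//.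
  by rewrite -mulrA mulrDl mulrDl mulVf ?gt_eqF// mulrDl addrAC addrA.
have h2 : a <= a * (1 + (r + W) * (a + A)).
  by rewrite -[leLHS]mulr1 ler_wpM2l// lerDl mulr_ge0// addr_ge0// ltW.
have h3 : e * (1 + (r + W) * A) <= e * (1 + (r + W) * (a + A)).
  by rewrite ler_wpM2l// lerD2l ler_wpM2l// lerDr.
by rewrite mulrDl; lra.
Qed.

(** The difference is the probability of being killed between generations [k] and [k + l]. *)
Lemma killed_tail (eta : R) : 0 < eta -> exists k, forall l,
  iterG 0 k 1 - iterG 0 (k + l) 1 <= eta.
Proof.
move=> eta0.
have [k hk] : exists k, forall n, killed 0 n <= killed 0 k + eta.
  apply: (@almost_sup _ _ 1) => // n.
  by have := iterG01_1 0 n; rewrite /killed; lra.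
by exists k => l; have := hk (k + l)%N; rewrite /killed; lra.
Qed.

(** Sufficiency of the three conditions. [D] bounds 1 / (mu_k y) uniformly, and [k] is taken so
    large that mu_k x is at most half of 1 / D; hence w = y - x stays away from 0. *)
Lemma alive_lower (eps A B : R) : 0 < eps -> (forall n, eps <= meanprod n) ->
  (forall n, window killing 0 n <= A) -> (forall n, window rho 0 n <= B) ->
  exists2 q, 0 < q & exists k, forall l, q <= alive 0 (k + l).
Proof.
move=> eps0 hmu hA hB.
have B0 : 0 <= B by have := hB 0; rewrite window0.
set D := eps^-1 + B; have D0 : 0 < D by rewrite ltr_wpDr// invr_gt0.
have [k hk] : exists k, forall n, window killing 0 n <=
    window killing 0 k + D^-1 / 2.
  by apply: (@almost_sup _ _ A) => //; rewrite divr_gt0// invr_gt0.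
have M0 := meanprod_gt0 k.
have tail l : D^-1 / 2 / meanprod k <= alive k l.
  rewrite ler_pdivrMr//.
  have h1 : window killing k l <= D^-1 / 2.
    by have := hk (k + l)%N; rewrite window_cat add0n; lra.
  have h2 := killed_upper k l.
  have h3 : D^-1 <= meanprod k * nonextinct k l.
    have := nonextinct_lower k l.
    have : (meanprod (k + l))^-1 + window rho k l <= D.
      rewrite lerD// ?lef_pV2 ?posrE ?meanprod_gt0//.
      have := hB (k + l)%N; rewrite window_cat add0n.
      by have := window_ge0 0 k rho_ge0; lra.
    set Q := (meanprod (k + l))^-1 + _ => QD hQ.
    rewrite -[leLHS]mul1r ler_pdivrMr// (le_trans hQ)//.
    rewrite ler_wpM2l// mulr_ge0 ?(ltW M0)// subr_ge0.
    by have /andP[] := iterG01_0 k l.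
  by move: h2 h3; rewrite /nonextinct /killed /alive; lra.
have q0 : 0 < D^-1 / 2 / meanprod k by rewrite !divr_gt0// invr_gt0.
(* As [k] is now fixed, the bound for generation [k] yields one for the first particle that does not
   depend on [l]. *)
have [q' q'0 hq'] := iterG_sep 0 k q0.
exists q' => //; exists k => l.
rewrite /alive !iterG_add add0n; apply: hq' => //.
- by have /andP[] := iterG01_0 k l.
- by have /andP[] := iterG01_1 k l.
- exact: tail.
Qed.

Lemma alive_le_meanprod n : alive 0 n <= meanprod n.
Proof.
have := alive_upper 0 n; rewrite meanprod0 mul1r add0n => h.
have : alive 0 n * (meanprod n)^-1 <= 1.
  apply: le_trans h; rewrite ler_wpM2l ?alive_ge0// lerDl.
  by rewrite mulr_ge0 ?(ltW kappa_gt0)// window_ge0//; exact: rho_ge0.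
by rewrite ler_pdivrMr ?meanprod_gt0// mul1r.
Qed.

(** Keeps only the [rho] part of [alive_upper], just as [alive_le_meanprod] keeps only 1 / mu_n. *)
Lemma window_rho_bounded (eps : R) : 0 < eps -> (forall n, eps <= alive 0 n) ->
  forall n, window rho 0 n <= (eps * kappa)^-1.
Proof.
move=> eps0 halive n; have := alive_upper 0 n; rewrite meanprod0 mul1r => h.
have W0 := window_ge0 0 n rho_ge0.
rewrite -(ler_pM2r (mulr_gt0 eps0 kappa_gt0)) mulVf ?gt_eqF ?mulr_gt0//.
apply: le_trans h; rewrite mulrC -mulrA.
rewrite ler_pM ?mulr_ge0 ?(ltW kappa_gt0) ?(ltW eps0)//.
by rewrite lerDr invr_ge0 ltW// meanprod_gt0.
Qed.

(* Once the window of killing rates outweighs mu_k, both sides are governed by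
   the same window of rho, so a single particle is killed at least as often,
   up to a constant, as it survives. *)
Lemma alive_le_killed k l : meanprod k <= window killing k l ->
  0 < killed k l /\ alive k l <= (1 + kappa^-1) * killed k l.
Proof.
move=> hA.
have M0 := meanprod_gt0 k.
have W0 : 0 <= window rho k l by apply/window_ge0/rho_ge0.
have A0 : 0 < window killing k l by exact: lt_le_trans hA.
have := killed_lower k l.
set y := meanprod k * killed k l; set A := window killing k l in A0 hA *.
set W := window rho k l in W0 *; move=> hy.
have WA0 : 0 < 1 + W * A by rewrite ltr_wpDr// mulr_ge0// ltW.
have y0 : 0 < y by rewrite -(pmulr_lgt0 _ WA0); exact: lt_le_trans hy.
have x0 : 0 < killed k l by rewrite -(pmulr_rgt0 _ M0).
split => //.
have w0 := alive_ge0 k l; have w1 := alive_le1 k l.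
have := alive_upper k l; rewrite -/W => hw.
have {}hw : meanprod k * alive k l * W <= kappa^-1.
  rewrite -(ler_pM2r kappa_gt0) mulVf ?gt_eqF//.
  have -> : meanprod k * alive k l * W * kappa =
    meanprod k * alive k l * (kappa * W) by ring.
  apply: le_trans hw; rewrite ler_wpM2l ?mulr_ge0 ?(ltW M0)//.
  by rewrite lerDr invr_ge0 ltW// meanprod_gt0.
rewrite -(ler_pM2l M0) -(ler_pM2r A0).
have -> : meanprod k * ((1 + kappa^-1) * killed k l) * A =
  (y + y * kappa^-1) * A by rewrite /y; ring.
(* After [hy] is inserted for [A], the first term uses [alive k l <= 1] and mu_k <= A, the second
   uses [hw]. *)
apply: (@le_trans _ _ (meanprod k * alive k l * (y * (1 + W * A)))).
  by rewrite ler_wpM2l// mulr_ge0// ltW.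
have -> : meanprod k * alive k l * (y * (1 + W * A)) =
  y * (alive k l * meanprod k) + y * (meanprod k * alive k l * W) * A by ring.
rewrite [leRHS]mulrDl; apply: lerD.
  rewrite ler_wpM2l ?(ltW y0)// (le_trans _ hA)//.
  by rewrite -[leRHS]mul1r ler_wpM2r// ltW.
by rewrite ler_wpM2r ?(ltW A0)// ler_wpM2l// ltW.
Qed.

Lemma window_killing_bounded (eps : R) : 0 < eps ->
  (forall n, eps <= alive 0 n) -> exists A, forall n, window killing 0 n <= A.
Proof.
move=> eps0 halive; apply: contrapT => /forallNP unb.
set C := 1 + kappa^-1.
have C0 : 0 < C by rewrite ltr_wpDr// invr_ge0 ltW.
(* Chosen so that [C] times the late killing probability is at most [eps / 2], below the survival
   bound [eps]. *)
have e20 : 0 < eps / C / 2 by rewrite !divr_gt0.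
have [k hk] := killed_tail e20.
(* The margin [meanprod k] makes the window after [k] exceed mu_k, as [alive_le_killed] requires. *)
have [n hn] : exists n, window killing 0 k + meanprod k < window killing 0 n.
  have /existsNP[n /negP] := unb (window killing 0 k + meanprod k).
  by rewrite -ltNge => ?; exists n.
have nk : (k <= n)%N.
  rewrite leqNgt; apply/negP => /ltnW nk; move: hn.
  rewrite -(subnKC nk) window_cat add0n => hn.
  have := window_ge0 n (k - n) killing_ge0.
  by have := meanprod_gt0 (n + (k - n)); lra.
have [l nE] : exists l, n = (k + l)%N by exists (n - k)%N; rewrite subnKC.
move: hn; rewrite nE window_cat add0n ltrD2l => /ltW/alive_le_killed[x0 hx].
have /andP[v0 _] := iterG01_0 k l.
have /andP[u0 u1] := iterG01_1 k l.
have vu : iterG k l 0 <= iterG k l 1 by rewrite iterG_nd.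
(* Convexity transfers the comparison of [alive k l] with [killed k l] through the first [k]
   generations: the increment for survival is at most [C] times that for killing. *)
have := iterG_cvx 0 k v0 vu u1 (lexx 1).
have : eps <= iterG 0 k (iterG k l 1) - iterG 0 k (iterG k l 0).
  by have := halive (k + l)%N; rewrite /alive !iterG_add add0n.
have : iterG 0 k 1 - iterG 0 k (iterG k l 1) <= eps / C / 2.
  by have := hk l; rewrite iterG_add add0n.
rewrite -/(killed k l) -/(alive k l).
move: (iterG 0 k 1 - iterG 0 k (iterG k l 1)) => D.
move: (iterG 0 k (iterG k l 1) - iterG 0 k (iterG k l 0)) => p.
move=> hD hp hpD.
have : killed k l * p <= killed k l * (eps / 2).
  apply: (le_trans hpD); apply: (@le_trans _ _ (eps / C / 2 * (C * killed k l))).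
    apply: ler_pM => //.
      rewrite leNgt; apply/negP => D0.
      have : killed k l * p <= 0.
        by apply: (le_trans hpD); rewrite mulr_le0_ge0 ?alive_ge0// ltW.
      by rewrite pmulr_rle0//; lra.
    exact: alive_ge0.
  rewrite le_eqVlt; apply/orP; left; apply/eqP; field.
  by rewrite gt_eqF.
by rewrite ler_pM2l//; lra.
Qed.

End iteration.

(** * Bounds for one generation *)

Section power_inequalities.
Context {R : realType}.
Implicit Types (u v t d s : R) (k : nat).

Lemma exprS_tangent (x y : R) k : 0 <= x -> 0 <= y ->
  x ^+ k.+1 + k.+1%:R * x ^+ k * (y - x) <= y ^+ k.+1.
Proof.
move=> x0 y0; elim: k => [|k IH]; first by rewrite !expr1 expr0; lra.
rewrite [leRHS]exprS; apply: le_trans (ler_wpM2l y0 IH).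
rewrite -subr_ge0.
have -> : y * (x ^+ k.+1 + k.+1%:R * x ^+ k * (y - x)) -
    (x ^+ k.+2 + k.+2%:R * x ^+ k.+1 * (y - x)) =
    k.+1%:R * x ^+ k * (y - x) ^+ 2.
  by rewrite !exprS -[k.+2]addn1 natrD; ring.
by rewrite mulr_ge0 ?sqr_ge0// mulr_ge0// exprn_ge0.
Qed.

(** Both slopes are compared with the slope of the tangent at [u]. *)
Lemma expr_convex v u t k : 0 <= v -> v <= u -> u <= t ->
  (t - u) * (u ^+ k - v ^+ k) <= (t ^+ k - u ^+ k) * (u - v).
Proof.
case: k => [|k] v0 vu ut; first by rewrite !expr0 !subrr mulr0 mul0r.
have u0 := le_trans v0 vu; have t0 := le_trans u0 ut.
have h1 : u ^+ k.+1 - v ^+ k.+1 <= k.+1%:R * u ^+ k * (u - v).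
  by have := exprS_tangent k u0 v0; lra.
have h2 : k.+1%:R * u ^+ k * (t - u) <= t ^+ k.+1 - u ^+ k.+1.
  by have := exprS_tangent k u0 t0; lra.
apply: (@le_trans _ _ (k.+1%:R * u ^+ k * (t - u) * (u - v))).
  by rewrite [_ * (t - u)]mulrC -mulrA ler_wpM2l// subr_ge0.
by rewrite ler_wpM2r// subr_ge0.
Qed.

Lemma expr_lipschitz v u k : 0 <= v -> v <= u -> u <= 1 ->
  u ^+ k - v ^+ k <= k%:R * (u - v).
Proof.
case: k => [|k] v0 vu u1; first by rewrite !expr0 subrr mul0r.
have u0 := le_trans v0 vu.
have h1 : u ^+ k.+1 - v ^+ k.+1 <= k.+1%:R * u ^+ k * (u - v).
  by have := exprS_tangent k u0 v0; lra.
apply: (le_trans h1); rewrite ler_wpM2r ?subr_ge0//.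
by rewrite -[leRHS]mulr1 ler_wpM2l// exprn_ile1.
Qed.

(** Among intervals of a given length in [0, 1], the power grows most on the one ending at 1. *)
Lemma expr_increment_le v u k : 0 <= v -> v <= u -> u <= 1 ->
  u ^+ k - v ^+ k <= 1 - (1 - (u - v)) ^+ k.
Proof.
move=> v0 vu u1; elim: k => [|k IH]; first by rewrite !expr0 !subrr.
have u0 := le_trans v0 vu.
have uk : u ^+ k <= 1 by rewrite exprn_ile1.
have vk : v ^+ k <= u ^+ k by rewrite lerXn2r.
rewrite !exprS.
have h1 : (u - v) * u ^+ k <= u - v.
  by rewrite -[leRHS]mulr1 ler_wpM2l// subr_ge0.
have h2 : v * (u ^+ k - v ^+ k) <= (1 - (u - v)) * (1 - (1 - (u - v)) ^+ k).
  by apply: ler_pM => //; lra.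
by lra.
Qed.

(** With n = k + 1 the bound on 1 - (1 - d)^n is n d / (1 + (n - 1) d / 2), which is concave in n.
    In the induction step the two sides differ by (k + 1)(k + 2) d^3. *)
Lemma one_sub_expr_upper d k : 0 <= d -> d <= 1 ->
  (2 + k%:R * d) * (1 - (1 - d) ^+ k.+1) <= 2 * k.+1%:R * d.
Proof.
move=> d0 d1; elim: k => [|k IH]; first by rewrite expr1 mul0r addr0; lra.
have k0 : 0 <= k%:R :> R by [].
have kd0 : 0 <= k%:R * d by rewrite mulr_ge0.
have q0 : 0 < 2 + k%:R * d by lra.
rewrite -(ler_pM2l q0).
move: IH; rewrite [(1 - d) ^+ k.+2]exprS; move: ((1 - d) ^+ k.+1) => x.
rewrite -[k.+2]addn1 natrD -[k.+1]addn1 natrD => IH.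
have -> : (2 + k%:R * d) * ((2 + (k%:R + 1) * d) * (1 - (1 - d) * x)) =
  (2 + (k%:R + 1) * d) * ((2 + k%:R * d) * d + (1 - d) * ((2 + k%:R * d) * (1 - x))).
  by ring.
have h : (2 + k%:R * d) * d + (1 - d) * ((2 + k%:R * d) * (1 - x)) <=
  (2 + k%:R * d) * d + (1 - d) * (2 * (k%:R + 1) * d).
  by rewrite lerD2l ler_wpM2l// subr_ge0.
have q'0 : 0 <= 2 + (k%:R + 1) * d by rewrite mulrDl; lra.
apply: (le_trans (ler_wpM2l q'0 h)).
rewrite -subr_ge0.
have -> : (2 + k%:R * d) * (2 * (k%:R + 1 + 1) * d) -
  (2 + (k%:R + 1) * d) *
   ((2 + k%:R * d) * d + (1 - d) * (2 * (k%:R + 1) * d)) =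
  (k%:R + 1) * (k%:R + 2) * d ^+ 3 by ring.
by rewrite mulr_ge0 ?exprn_ge0// mulr_ge0; lra.
Qed.

(** Follows from (1 - d)^k (1 + k d) <= 1 on multiplying by 1 - d. *)
Lemma one_sub_expr_lower d k : 0 <= d -> d <= 1 ->
  k.+1%:R * d <= (1 - (1 - d) ^+ k.+1) * (1 + k%:R * d).
Proof.
move=> d0 d1.
have h : (1 - d) ^+ k * (1 + k%:R * d) <= 1.
  elim: k => [|k IH]; first by rewrite expr0 mul0r addr0 mul1r.
  apply: le_trans IH; rewrite exprSr -mulrA ler_wpM2l ?exprn_ge0 ?subr_ge0//.
  rewrite -subr_ge0 -[k.+1]addn1 natrD.
  have -> : 1 + k%:R * d - (1 - d) * (1 + (k%:R + 1) * d) =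
    (k%:R + 1) * d ^+ 2 by ring.
  by rewrite mulr_ge0 ?sqr_ge0// addr_ge0.
have := ler_wpM2l (_ : 0 <= 1 - d) h; rewrite subr_ge0 => /(_ d1).
rewrite exprS -[k.+1]addn1 natrD; move: ((1 - d) ^+ k) => x.
by lra.
Qed.

Lemma expr_superadditive v u k : 0 <= v -> v <= u ->
  (u - v) ^+ k.+1 <= u ^+ k.+1 - v ^+ k.+1.
Proof.
move=> v0 vu; have u0 := le_trans v0 vu.
elim: k => [|k IH]; first by rewrite !expr1.
have vk : v ^+ k.+1 <= u ^+ k.+1 by rewrite lerXn2r.
have := ler_wpM2l (_ : 0 <= u - v) IH; rewrite subr_ge0 => /(_ vu).
rewrite ![_ ^+ k.+2]exprS => h; apply: (le_trans h).
have : 0 <= v * (u ^+ k.+1 - v ^+ k.+1) by rewrite mulr_ge0// subr_ge0.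
have : 0 <= (u - v) * v ^+ k.+1 by rewrite mulr_ge0 ?subr_ge0// exprn_ge0.
by lra.
Qed.

(* The left-hand side is the tangent at q = tau^-1. *)
Lemma invr_tangent (q tau : R) : 0 < q -> 2 * tau - tau ^+ 2 * q <= q^-1.
Proof.
move=> q0; rewrite -subr_ge0.
have -> : q^-1 - (2 * tau - tau ^+ 2 * q) = (1 - tau * q) ^+ 2 / q.
  by field; rewrite gt_eqF.
by rewrite divr_ge0 ?sqr_ge0// ltW.
Qed.

End power_inequalities.

(** * Real series weighted by an offspring distribution *)

Section weighted_sums.
Context {R : realType}.
Variable g : nat -> R.
Implicit Types (h : nat -> R) (s : seq (R * (nat -> R))).

Definition weighted h : R^nat := fun k => g k * h k.

(** A limit in [R], meaningful only for a convergent series; hence the convergence premises that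
    accompany it. *)
Definition wsum h : R := limn (series (weighted h)).

Lemma cvg_wsum_lincomb s :
  (forall p, p \in s -> cvgn (series (weighted p.2))) ->
  series (weighted (fun k => \sum_(p <- s) p.1 * p.2 k)) @ \oo -->
  \sum_(p <- s) p.1 * wsum p.2.
Proof.
elim: s => [|p s IH] hs.
  rewrite big_nil (_ : series _ = fun=> 0); first exact: cvg_cst.
  apply/funext => n; rewrite /series /= big1// => k _.
  by rewrite /weighted big_nil mulr0.
rewrite big_cons.
have -> : series (weighted (fun k => \sum_(j <- p :: s) j.1 * j.2 k)) =
  (fun n => p.1 * series (weighted p.2) n +
    series (weighted (fun k => \sum_(j <- s) j.1 * j.2 k)) n).
  apply/funext => n; rewrite /series /= mulr_sumr -big_split /=.
  by apply: eq_bigr => k _; rewrite /weighted big_cons mulrDr mulrCA.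
apply: cvgD.
  by apply: cvgMr; apply: hs; rewrite mem_head.
by apply: IH => q qs; apply: hs; rewrite inE qs orbT.
Qed.

(** Reduces a linear inequality between moments and generating functions to an inequality for each
    number of children. Most estimates for one generation are obtained this way, from a list of
    coefficients and integrands. *)
Lemma wsum_lincomb_ge0 s :
  (forall p, p \in s -> cvgn (series (weighted p.2))) ->
  (forall k, 0 <= g k * \sum_(p <- s) p.1 * p.2 k) ->
  0 <= \sum_(p <- s) p.1 * wsum p.2.
Proof.
move=> /cvg_wsum_lincomb hs h0; rewrite -(cvg_lim _ hs)//.
apply: limr_ge; first by apply/cvg_ex; eexists; exact: hs.
by apply: nearW => n; rewrite /series /= sumr_ge0// => k _; exact: h0.
Qed.

Hypothesis g_ge0 : forall k, 0 <= g k.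

Lemma wsum_ge_term h j : (forall k, 0 <= h k) ->
  cvgn (series (weighted h)) -> g j * h j <= wsum h.
Proof.
move=> h0 hc; have gh0 k : 0 <= weighted h k by rewrite mulr_ge0.
apply: (@le_trans _ _ (series (weighted h) j.+1)).
  by rewrite seriesSr lerDr /series /= sumr_ge0.
apply: nondecreasing_cvgn_le => //.
by apply/nondecreasing_seqP => n; rewrite seriesSr lerDl.
Qed.

Lemma EFin_wsum h : (forall k, 0 <= h k) ->
  (\sum_(0 <= k <oo) (g k * h k)%:E < +oo)%E ->
  cvgn (series (weighted h)) /\
  (\sum_(0 <= k <oo) (g k * h k)%:E = (wsum h)%:E)%E.
Proof.
move=> h0 hfin.
have gh0 k : 0 <= weighted h k by rewrite mulr_ge0.
have hc : cvgn (series (weighted h)) by exact: nnseries_is_cvg.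
split=> //; rewrite /wsum -EFin_lim//; congr (limn _).
by apply/funext => n; rewrite /series /= sumEFin.
Qed.

End weighted_sums.

(** * Estimates for the generating function of one offspring distribution *)

Section generating_function.
Context {R : realType}.
Variables (g : nat -> R) (c : R).

(** Puts the restriction to {X >= n} into the integrand, so that truncated moments are again values
    of [wsum]. *)
Definition at_least (n : nat) (h : nat -> R) : nat -> R :=
  fun k => (n <= k)%:R * h k.

Definition pgf (s : R) : R := wsum g (fun k => s ^+ k).
Definition mean : R := wsum g (fun k => k%:R).
Definition fact2 : R := wsum g (fun k => k%:R * (k%:R - 1)).

Let one : nat -> R := fun=> 1.
Let idR : nat -> R := fun k => k%:R.
Let sqR : nat -> R := fun k => k%:R ^+ 2.

Hypothesis g_ge0 : forall k, 0 <= g k.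
Hypothesis cvg_one : cvgn (series (weighted g one)).
Hypothesis cvg_idR : cvgn (series (weighted g idR)).

Let cvg_at_least1 : cvgn (series (weighted g (at_least 1 one))).
Proof.
apply: series_le_cvg cvg_one => k; rewrite /weighted ?mulr_ge0//.
by rewrite ler_wpM2l// /at_least /one mulr1 lern1 leq_b1.
Qed.

Let pos := wsum g (at_least 1 one).

Hypothesis mean_gt0 : 0 < mean.

Lemma exists_positive_weight : exists j, 0 < g j.+1.
Proof.
apply: contrapT => /forallNP h.
have := mean_gt0; apply/negP; rewrite -leNgt.
have := @wsum_lincomb_ge0 _ g [:: (-1, idR)].
rewrite !big_cons !big_nil /= addr0 mulN1r oppr_ge0; apply.
  by move=> p; rewrite inE => /eqP ->.
move=> [|j]; rewrite big_cons big_nil /= addr0 mulN1r mulrN /idR ?mulr0 ?oppr0//.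
have /negP := h j; rewrite -leNgt => gj.
have -> : g j.+1 = 0 by apply/le_anti; rewrite gj g_ge0.
by rewrite mul0r oppr0.
Qed.

Lemma pos_gt0 : 0 < pos.
Proof.
have [j gj] := exists_positive_weight.
apply: (lt_le_trans gj); rewrite -[leLHS]mulr1.
have -> : 1 = at_least 1 one j.+1 by rewrite /at_least /one mulr1.
by apply: wsum_ge_term => // k; rewrite /at_least /one mulr1 ler0n.
Qed.

Hypothesis cvg_sqR : cvgn (series (weighted g (at_least 2 sqR))).

Let cvg_dominated h : (forall k, 0 <= h k <= 1 + k%:R ^+ 2) ->
  cvgn (series (weighted g h)).
Proof.
move=> hb.
(* Only the square truncated to k >= 2 is known to be summable; [one] and [idR] cover k = 0 and k =
   1. *)
have hs (p : R * (nat -> R)) : p \in [:: (1, one); (1, idR); (1, at_least 2 sqR)] ->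
    cvgn (series (weighted g p.2)).
  by rewrite !inE => /or3P[] /eqP ->.
have /cvgP := cvg_wsum_lincomb hs; apply: series_le_cvg => k.
- by rewrite /weighted mulr_ge0//; have /andP[] := hb k.
- rewrite /weighted mulr_ge0// !big_cons big_nil /= !mul1r addr0.
  by rewrite /one /idR /at_least /sqR addr_ge0// addr_ge0// mulr_ge0.
- rewrite /weighted ler_wpM2l// !big_cons big_nil /= !mul1r addr0.
  have /andP[_] := hb k; rewrite /one /idR /at_least /sqR.
  move: k => [|[|k]] /le_trans; apply; rewrite ?expr0n ?mul0r ?mul1r ?addr0//=.
  - by rewrite expr1n.
  - by rewrite lerD2l lerDr.
Qed.

Let cvg_expr s : 0 <= s -> s <= 1 -> cvgn (series (weighted g (fun k => s ^+ k))).
Proof.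
move=> s0 s1; apply: cvg_dominated => k; rewrite exprn_ge0//=.
by rewrite (le_trans (exprn_ile1 k s0 s1))// lerDl sqr_ge0.
Qed.

Let nat_le_sqr k : k%:R <= 1 + k%:R ^+ 2 :> R.
Proof.
rewrite -natrX -[1]/(1%:R) -natrD ler_nat add1n; case: k => // k.
by rewrite (leq_trans _ (leqnSn _))// leq_pmulr.
Qed.

Let cvg_fact2 : cvgn (series (weighted g (fun k => k%:R * (k%:R - 1)))).
Proof.
apply: cvg_dominated => -[|k]; first by rewrite mul0r lexx expr0n addr0 ler01.
have k0 : 0 <= k.+1%:R - 1 :> R by rewrite subr_ge0 ler1n.
rewrite mulr_ge0//= expr2 mulrBr mulr1.
by have : 0 <= k.+1%:R :> R by []; lra.
Qed.

Let cvg_at_least2 : cvgn (series (weighted g (at_least 2 idR))).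
Proof.
apply: cvg_dominated => k; rewrite mulr_ge0//= /at_least /idR.
by case: (1 < k)%N; rewrite ?mul1r ?nat_le_sqr// mul0r addr_ge0.
Qed.

Lemma fact2_ge0 : 0 <= fact2.
Proof.
have := @wsum_lincomb_ge0 _ g [:: (1, fun k => k%:R * (k%:R - 1))].
rewrite !big_cons !big_nil /= addr0 mul1r; apply.
  by move=> p; rewrite inE => /eqP ->.
move=> k; rewrite big_cons big_nil /= addr0 mul1r mulr_ge0//.
by case: k => [|k]; rewrite ?mul0r// mulr_ge0// subr_ge0 ler1n.
Qed.

Lemma pgf_le v u : 0 <= v -> v <= u -> u <= 1 -> pgf v <= pgf u.
Proof.
move=> v0 vu u1; have u0 := le_trans v0 vu; have v1 := le_trans vu u1.
have := @wsum_lincomb_ge0 _ g [:: (1, fun k => u ^+ k); (-1, fun k => v ^+ k)].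
rewrite !big_cons !big_nil /= addr0 mul1r mulN1r subr_ge0; apply.
  by move=> p; rewrite !inE => /orP[] /eqP -> /=; exact: cvg_expr.
move=> k; rewrite !big_cons big_nil /= addr0 mul1r mulN1r.
by rewrite mulr_ge0// subr_ge0 lerXn2r.
Qed.

Hypothesis pgf1_le1 : pgf 1 <= 1.

Lemma pgf_unit : unit_interval_map pgf.
Proof.
move=> u /andP[u0 u1]; apply/andP; split; last first.
  exact: le_trans (pgf_le u0 u1 (lexx 1)) _.
have := @wsum_lincomb_ge0 _ g [:: (1, fun k => u ^+ k)].
rewrite !big_cons !big_nil /= addr0 mul1r; apply.
  by move=> p; rewrite !inE => /eqP -> /=; exact: cvg_expr.
by move=> k; rewrite !big_cons big_nil /= addr0 mul1r mulr_ge0// exprn_ge0.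
Qed.

Lemma pgf_convex : convex01 pgf.
Proof.
move=> v u t v0 vu ut t1; have u0 := le_trans v0 vu; have t0 := le_trans u0 ut.
have u1 := le_trans ut t1; have v1 := le_trans vu u1.
have := @wsum_lincomb_ge0 _ g [:: (u - v, fun k => t ^+ k);
  (v - t, fun k => u ^+ k); (t - u, fun k => v ^+ k)].
rewrite !big_cons !big_nil /= -![wsum _ _]/(pgf _) => h.
have : 0 <= (u - v) * pgf t + ((v - t) * pgf u + ((t - u) * pgf v + 0)).
  apply: h.
    by move=> p; rewrite !inE => /or3P[] /eqP -> /=; exact: cvg_expr.
  move=> k; rewrite !big_cons big_nil /= mulr_ge0//.
  by have := expr_convex k v0 vu ut; lra.
by lra.
Qed.

Lemma pgf_lipschitz v u : 0 <= v -> v <= u -> u <= 1 ->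
  pgf u - pgf v <= mean * (u - v).
Proof.
move=> v0 vu u1; have u0 := le_trans v0 vu; have v1 := le_trans vu u1.
have := @wsum_lincomb_ge0 _ g [:: (u - v, idR);
  (-1, fun k => u ^+ k); (1, fun k => v ^+ k)].
rewrite !big_cons !big_nil /= -/mean -![wsum _ _]/(pgf _) => h.
have : 0 <= (u - v) * mean + (-1 * pgf u + (1 * pgf v + 0)).
  apply: h.
    by move=> p; rewrite !inE => /or3P[] /eqP -> //=; exact: cvg_expr.
  move=> k; rewrite !big_cons big_nil /= mulr_ge0// /idR.
  by have := expr_lipschitz k v0 vu u1; lra.
by lra.
Qed.

(** A single positive weight at some j + 1 >= 1 suffices: its term alone grows by at least its
    multiple of (u - v)^(j+1). *)
Lemma pgf_separating : separating01 pgf.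
Proof.
have [j gj] := exists_positive_weight.
move=> q q0; exists (g j.+1 * q ^+ j.+1); first by rewrite mulr_gt0// exprn_gt0.
move=> v u v0 u1 quv; have vu : v <= u by lra.
have u0 := le_trans v0 vu; have v1 := le_trans vu u1.
have hs (p : R * (nat -> R)) :
    p \in [:: (1, fun k => u ^+ k); (-1, fun k => v ^+ k)] ->
    cvgn (series (weighted g p.2)).
  by rewrite !inE => /orP[] /eqP -> /=; exact: cvg_expr.
have := cvg_wsum_lincomb hs.
rewrite !big_cons !big_nil /= addr0 mul1r mulN1r -![wsum _ _]/(pgf _) => hc.
rewrite -(cvg_lim _ hc)//.
apply: le_trans (@wsum_ge_term _ _ g_ge0 _ j.+1 _ _) => /=.
- rewrite ler_wpM2l// !big_cons big_nil /= addr0 mul1r mulN1r.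
  apply: le_trans (expr_superadditive j v0 vu).
  by rewrite lerXn2r ?nnegrE ?(ltW q0)// subr_ge0.
- move=> k; rewrite !big_cons big_nil /= addr0 mul1r mulN1r subr_ge0.
  by rewrite lerXn2r.
- by apply/cvg_ex; eexists; exact: hc.
Qed.

(** Summing 1 - (1 - d)^k >= k d / (1 + (k - 1) d) amounts to Jensen's inequality for the reciprocal
    under the size-biased weights k g_k / mean. *)
Lemma pgf_lower v : 0 <= v -> v <= 1 ->
  mean * (1 - v) <= (pgf 1 - pgf v) * (1 + fact2 / mean * (1 - v)).
Proof.
move=> v0 v1; set d := 1 - v.
have d0 : 0 <= d by rewrite subr_ge0.
have d1 : d <= 1 by rewrite /d; lra.
have den0 : 0 < mean + fact2 * d by rewrite ltr_wpDr// mulr_ge0// fact2_ge0.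
(* The reciprocal of the size-biased mean of 1 + (k - 1) d; the tangent to the reciprocal is taken
   there. *)
set t := mean / (mean + fact2 * d).
have := @wsum_lincomb_ge0 _ g [:: (1, fun k => 1 ^+ k); (-1, fun k => v ^+ k);
  (t ^+ 2 * d - 2 * t * d, idR); (t ^+ 2 * d ^+ 2, fun k => k%:R * (k%:R - 1))].
rewrite !big_cons !big_nil /= -/mean -/fact2 -/(pgf 1) -/(pgf v) => h.
have {}h : 0 <= 1 * pgf 1 + (-1 * pgf v + ((t ^+ 2 * d - 2 * t * d) * mean +
    (t ^+ 2 * d ^+ 2 * fact2 + 0))).
  apply: h.
    move=> p; rewrite !inE => /orP[|/or3P[]] /eqP -> //=; exact: cvg_expr.
  move=> k; rewrite !big_cons big_nil /= mulr_ge0// /idR expr1n.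
  case: k => [|k]; first by rewrite expr0; lra.
  have q0 : 0 < 1 + k%:R * d by rewrite ltr_wpDr// mulr_ge0.
  have h1 := one_sub_expr_lower k d0 d1.
  have h2 := invr_tangent t q0.
  have h3 : k.+1%:R * d / (1 + k%:R * d) <= 1 - (1 - d) ^+ k.+1.
    by rewrite ler_pdivrMr.
  have h4 : k.+1%:R * d * (2 * t - t ^+ 2 * (1 + k%:R * d)) <=
      k.+1%:R * d / (1 + k%:R * d).
    by rewrite ler_wpM2l// mulr_ge0.
  have -> : v = 1 - d by rewrite /d; ring.
  rewrite -[k.+1]addn1 natrD in h3 h4 *; lra.
have {}h : mean ^+ 2 * d / (mean + fact2 * d) <= pgf 1 - pgf v.
  rewrite -subr_ge0; apply: le_trans h _; rewrite le_eqVlt; apply/orP; left.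
  by apply/eqP; rewrite /t; field; rewrite gt_eqF.
rewrite ler_pdivrMr// in h.
rewrite -(ler_pM2l mean_gt0); apply: le_trans (le_trans _ h) _.
  by rewrite mulrA -expr2.
by rewrite le_eqVlt; apply/orP; left; apply/eqP; field; rewrite gt_eqF.
Qed.

(* Summing the bound (u^k - v^k)(2 + (k-1)d) <= 2kd, with d = u - v, is
   Jensen's inequality for the concave map k |-> kd / (1 + (k-1)d/2): the
   right-hand side is its value at the conditional mean given k >= 1. *)
Lemma pgf_increment_le v u : 0 <= v -> v <= u -> u <= 1 ->
  (pgf u - pgf v) * (1 + (mean / pos - 1) / 2 * (u - v)) <= mean * (u - v).
Proof.
move=> v0 vu u1; have u0 := le_trans v0 vu; have v1 := le_trans vu u1.
have P0 := pos_gt0.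
set d := u - v; have d0 : 0 <= d by rewrite subr_ge0.
have d1 : d <= 1 by rewrite /d; lra.
have e0 : 0 < 2 - d by lra.
have Q0 : 0 < 2 - d + mean / pos * d.
  by rewrite ltr_wpDr// mulr_ge0// divr_ge0 ?ltW.
(* The reciprocal of 2 + (k - 1) d at k = [mean / pos], the mean conditioned on having children. *)
set t := (2 - d + mean / pos * d)^-1.
have := @wsum_lincomb_ge0 _ g [:: (-1, fun k => u ^+ k); (1, fun k => v ^+ k);
  (2 - 4 * (2 - d) * t + 2 * (2 - d) ^+ 2 * t ^+ 2, at_least 1 one);
  (2 * (2 - d) * t ^+ 2 * d, idR)].
rewrite !big_cons !big_nil /= -/mean -/pos -/(pgf u) -/(pgf v) => h.
have {}h : 0 <= -1 * pgf u + (1 * pgf v +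
  ((2 - 4 * (2 - d) * t + 2 * (2 - d) ^+ 2 * t ^+ 2) * pos +
   (2 * (2 - d) * t ^+ 2 * d * mean + 0))).
  apply: h.
    move=> p; rewrite !inE => /orP[|/or3P[]] /eqP -> //=; exact: cvg_expr.
  move=> k; rewrite !big_cons big_nil /= mulr_ge0// /idR /at_least /one.
  case: k => [|k]; first by rewrite !expr0 /=; lra.
  have k0 : 0 <= k%:R * d by rewrite mulr_ge0.
  have q0 : 0 < 2 + k%:R * d by lra.
  have h1 := one_sub_expr_upper k d0 d1.
  have h2 := invr_tangent t q0.
  have h3 : 1 - (1 - d) ^+ k.+1 <= 2 * k.+1%:R * d / (2 + k%:R * d).
    by rewrite ler_pdivlMr// mulrC.
  (* The bound is affine in the reciprocal of 2 + k d, so the tangent at [t] makes it linear in the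
     number of children. *)
  have h4 : 2 * k.+1%:R * d / (2 + k%:R * d) =
      2 - 2 * (2 - d) * (2 + k%:R * d)^-1.
    by rewrite -[k.+1]addn1 natrD; field; rewrite gt_eqF.
  have h5 : 2 * (2 - d) * (2 * t - t ^+ 2 * (2 + k%:R * d)) <=
      2 * (2 - d) * (2 + k%:R * d)^-1.
    by rewrite ler_wpM2l// mulr_ge0// ltW.
  have h6 := expr_increment_le k.+1 v0 vu u1.
  rewrite -/d h4 in h3 h6; rewrite /= -[k.+1]addn1 natrD; rewrite addn1.
  by lra.
have {}h : pgf u - pgf v <= 2 * mean * d / (2 - d + mean / pos * d).
  rewrite -subr_ge0; apply: le_trans h _; rewrite le_eqVlt; apply/orP; left.
  apply/eqP; rewrite /t; field; rewrite (gt_eqF P0) /=.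
  apply/eqP => e; move: Q0; rewrite (_ : 2 - d + mean / pos * d =
    ((2 - d) * pos + mean * d) / pos); last by field; rewrite gt_eqF.
  by rewrite e mul0r ltxx.
rewrite ler_pdivlMr// in h.
rewrite -(@ler_pM2l _ 2)//; apply: le_trans (le_trans _ h) _; last by rewrite mulrA.
by rewrite le_eqVlt; apply/orP; left; apply/eqP; field; rewrite gt_eqF.
Qed.

Hypothesis c_gt0 : 0 < c.
Hypothesis moment_bound :
  wsum g (at_least 2 sqR) * pos <= c * wsum g (at_least 2 idR) * mean.

(** Here the moment assumption enters. Since k <= 2 (k - 1) for k >= 2, E[X; X >= 2] is at most 2
    (mean - pos); this factor 2 and the 2 in the Jensen bound make up the 4 in [4 * c]. *)
Lemma fact2_le : (4 * c)^-1 * (fact2 / mean) <= (mean / pos - 1) / 2.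
Proof.
have P0 := pos_gt0.
have hS : fact2 <= wsum g (at_least 2 sqR).
  have := @wsum_lincomb_ge0 _ g [:: (1, at_least 2 sqR);
    (-1, fun k => k%:R * (k%:R - 1))].
  rewrite !big_cons !big_nil /= addr0 mul1r mulN1r subr_ge0; apply.
    by move=> p; rewrite !inE => /orP[] /eqP -> /=.
  move=> k; rewrite !big_cons big_nil /= addr0 mul1r mulN1r mulr_ge0//.
  rewrite /at_least /sqR; case: k => [|[|k]]; rewrite ?mul0r ?subrr ?mulr0 ?subr0//=.
  by rewrite mul1r expr2; have : 0 <= k.+2%:R :> R by []; lra.
have hT : wsum g (at_least 2 idR) <= 2 * (mean - pos).
  have := @wsum_lincomb_ge0 _ g [:: (2, idR); (-2, at_least 1 one);
    (-1, at_least 2 idR)].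
  rewrite !big_cons !big_nil /= -/mean -/pos => h.
  have : 0 <= 2 * mean + (-2 * pos + (-1 * wsum g (at_least 2 idR) + 0)).
    apply: h.
      by move=> p; rewrite !inE => /or3P[] /eqP ->.
    move=> k; rewrite !big_cons big_nil /= mulr_ge0//.
    rewrite /at_least /idR /one; case: k => [|[|k]] /=; [lra..|].
    by rewrite -[k.+2]addn2 natrD; have : 0 <= k%:R :> R by []; lra.
  by lra.
have h : fact2 * pos <= c * (2 * (mean - pos)) * mean.
  apply: le_trans (le_trans moment_bound _).
    by rewrite ler_wpM2r// ltW.
  by rewrite ler_wpM2r ?(ltW mean_gt0)// ler_wpM2l// ltW.
have D0 : 0 < 4 * c * mean * pos by rewrite !mulr_gt0.
rewrite -(ler_pM2r D0).
have -> : (4 * c)^-1 * (fact2 / mean) * (4 * c * mean * pos) = fact2 * pos.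
  by field; rewrite !gt_eqF.
have -> : (mean / pos - 1) / 2 * (4 * c * mean * pos) =
    c * (2 * (mean - pos)) * mean.
  by field; rewrite !gt_eqF.
exact: h.
Qed.

Lemma pgf_offspring_map : offspring_map (4 * c)^-1 pgf mean fact2.
Proof.
split.
- exact: pgf_unit.
- by move=> v u v0 vu u1; exact: pgf_le.
- exact: pgf_convex.
- exact: pgf_separating.
- exact: mean_gt0.
- exact: fact2_ge0.
- exact: pgf_lipschitz.
- move=> v u v0 vu u1; apply: le_trans (pgf_increment_le v0 vu u1).
  rewrite ler_wpM2l ?subr_ge0 ?pgf_le// lerD2l ler_wpM2r ?subr_ge0//.
  exact: fact2_le.
- exact: pgf_lower.
Qed.

End generating_function.

(** * The generating function of Z_n *)

Local Open Scope ereal_scope.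

Lemma addDA : associative addD.
Proof. by case=> [x|] [y|] [z|] //=; rewrite addnA. Qed.

Lemma addDC : commutative addD.
Proof. by case=> [x|] [y|] //=; rewrite addnC. Qed.

Lemma add0D : left_id (state 0) addD.
Proof. by case. Qed.

HB.instance Definition _ := Monoid.isComLaw.Build Ndelta (state 0) addD
  addDA addDC add0D.

(** The preimage of Delta is the complement of the union of the others, so the numbers suffice. *)
Lemma measurable_fun_Ndelta d (T : measurableType d) (Y : T -> Ndelta) :
  (forall k, measurable (Y @^-1` [set state k])) -> measurable_fun setT Y.
Proof.
move=> mY _ B _; rewrite setTI.
pose U := \bigcup_k (Y @^-1` [set state k]).
have mU : measurable U by exact: bigcup_measurable.
have -> : Y @^-1` B = \bigcup_(k in [set k | B (state k)]) (Y @^-1` [set state k])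
    `|` (if pselect (B Delta) then ~` U else set0).
  apply/seteqP; split => w /=.
    case: pselect => BD BY; last first.
      left; case YE : (Y w) BY => [k|]//= Bk; first by exists k.
    case YE : (Y w) BY => [k|]//= Bk; first by left; exists k.
    by right=> -[k _] /=; rewrite YE.
  case=> [[k Bk] /= -> //|]; case: pselect => // BD nU.
  case YE : (Y w) => [k|]//.
  by exfalso; apply: nU; exists k.
apply: measurableU; first exact: bigcup_measurable.
by case: (pselect (B Delta)) => ? /=; [exact: measurableC|exact: measurable0].
Qed.

Section split_integral.
Context {d : measure_display} {T : measurableType d} {R : realType}.
Variable mu : {measure set T -> \bar R}.

Lemma integral_Ndelta (Y : T -> Ndelta) (E : set T) (h : T -> \bar R) :
  measurable E -> measurable_fun setT Y -> measurable_fun setT h ->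
  (forall w, 0 <= h w) -> (forall w, Y w = Delta -> h w = 0) ->
  \int[mu]_(w in E) h w =
    \sum_(0 <= k <oo) \int[mu]_(w in E `&` Y @^-1` [set state k]) h w.
Proof.
move=> mE mY mh h0 hD.
(* Index 0 stands for Delta and n + 1 for [state n]; the Delta piece, where [h] vanishes, is then
   split off. *)
pose F n := E `&` Y @^-1` [set if n is k.+1 then state k else Delta].
have mF n : measurable (F n).
  by apply: measurableI => //; rewrite -[_ @^-1` _]setTI; exact: mY.
have EF : E = \bigcup_n F n.
  apply/seteqP; split => w; last by case=> n _ [].
  move=> Ew; case YE : (Y w) => [k|]; first by exists k.+1.
  by exists 0%N.
rewrite [in LHS]EF ge0_integral_bigcup//; last 2 first.
- exact: measurable_funTS.
- move=> i j _ _ [w [[_ /= Yi] [_ /= Yj]]].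
  by move: Yj; rewrite Yi; case: i j {Yi} => [|i] [|j]//= [->].
rewrite nneseries_recl//; last by move=> k _; exact: integral_ge0.
rewrite [X in X + _](_ : _ = 0) ?add0e; last first.
  by rewrite integral0_eq// => w [_ /= Yw]; exact: hD.
rewrite -[LHS](nneseries_addn (f := fun n => \int[mu]_(w in F n) h w) 1); last first.
  by move=> k; exact: integral_ge0.
by apply: eq_eseriesr => k _; rewrite addn1.
Qed.

End split_integral.

(** * Independence of the generations and the law of Z_n *)

Section offspring.
Context {d : measure_display} {Omega : measurableType d} {R : realType}.
Variables (P : probability Omega R) (f : nat -> nat -> R).
Variable X : nat -> nat -> {RV P >-> Ndelta}.
Hypothesis hX : offspring_array f X.

Let index := (nat * nat)%type.
Implicit Types (s : seq index) (B : index -> set Ndelta) (J : set index).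

Definition valid_index : set index := [set i | (0 < i.1)%N /\ (0 < i.2)%N].

Definition cylinder s B : set Omega :=
  \bigcap_(i in [set` s]) ((X i.1 i.2 : Omega -> Ndelta) @^-1` B i).

Lemma measurable_X n j (A : set Ndelta) :
  measurable ((X n j : Omega -> Ndelta) @^-1` A).
Proof. exact: measurable_funPTI. Qed.

Lemma cylinder_nil B : cylinder [::] B = setT.
Proof. by apply/seteqP; split => // w _ j. Qed.

Lemma cylinder_cons i s B : cylinder (i :: s) B =
  ((X i.1 i.2 : Omega -> Ndelta) @^-1` B i) `&` cylinder s B.
Proof.
rewrite /cylinder; apply/seteqP; split => [w h|w [h1 h2] j /=].
  split; first by apply: (h i); rewrite /= mem_head.
  by move=> j /= js; apply: (h j); rewrite /= inE js orbT.
by rewrite inE => /orP[/eqP ->//|]; exact: h2.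
Qed.

Lemma measurable_cylinder s B : measurable (cylinder s B).
Proof.
elim: s => [|i s IH]; first by rewrite cylinder_nil.
by rewrite cylinder_cons; apply: measurableI => //; exact: measurable_X.
Qed.

(** Independence of [E] from the variables indexed by [J], tested on finite cylinders, so that no
    generated sigma-algebra is needed. *)
Definition independent_of (E : set Omega) J := measurable E /\
  forall s B, uniq s -> [set` s] `<=` J ->
    P (E `&` cylinder s B) = P E * P (cylinder s B).

Lemma independent_of_sub E J J' : J' `<=` J ->
  independent_of E J -> independent_of E J'.
Proof.
by move=> JJ' [mE hE]; split=> // s B us sJ; apply: hE => // i /sJ /JJ'.
Qed.

Lemma independent_of_setT J : independent_of setT J.
Proof. by split => // s B _ _; rewrite setTI probability_setT mul1e. Qed.

Lemma independent_of_set0 J : independent_of set0 J.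
Proof. by split => // s B _ _; rewrite set0I measure0 mul0e. Qed.

Lemma eq_cylinder s B B' : {in s, B =1 B'} -> cylinder s B = cylinder s B'.
Proof.
by move=> BB'; apply: eq_bigcapr => i /= /BB' ->.
Qed.

Lemma cylinderE s B : uniq s -> [set` s] `<=` valid_index ->
  P (cylinder s B) = \prod_(i <- s) P ((X i.1 i.2 : Omega -> Ndelta) @^-1` B i).
Proof. by case: hX => h _ _ us sJ; apply: h. Qed.

(** A condition on one variable can be absorbed into the event, at the price of its index. This
    drives the inductions below. *)
Lemma independent_of_preimage E J i (A : set Ndelta) : J `<=` valid_index ->
  J i -> independent_of E J ->
  P (E `&` X i.1 i.2 @^-1` A) = P E * P (X i.1 i.2 @^-1` A) /\
  independent_of (E `&` X i.1 i.2 @^-1` A) (J `\ i).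
Proof.
move=> Jv Ji [mE hE].
have single : cylinder [:: i] (fun=> A) = X i.1 i.2 @^-1` A.
  by rewrite cylinder_cons cylinder_nil setIT.
have PEA : P (E `&` X i.1 i.2 @^-1` A) = P E * P (X i.1 i.2 @^-1` A).
  by rewrite -single hE// => j /=; rewrite inE => /eqP ->.
split=> //; split; first by apply: measurableI => //; exact: measurable_X.
move=> s B us sJ.
have is' : i \notin s by apply/negP => /sJ [] _; apply.
pose B' j := if j == i then A else B j.
have BB' : {in s, B =1 B'}.
  by move=> j js; rewrite /B'; case: eqP => // ji; rewrite -ji js in is'.
have consE : X i.1 i.2 @^-1` A `&` cylinder s B = cylinder (i :: s) B'.
  by rewrite cylinder_cons (eq_cylinder BB') /B' eqxx.
have us' : uniq (i :: s) by rewrite /= is'.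
have sJ' : [set` i :: s] `<=` J.
  by move=> j /=; rewrite inE => /orP[/eqP ->//|/sJ []].
rewrite -setIA consE hE// PEA cylinderE//; last by move=> j /sJ' /Jv.
rewrite big_cons {1}/B' eqxx muleA; congr (_ * _).
rewrite cylinderE//; last by move=> j /sJ [] /Jv.
by rewrite big_seq [RHS]big_seq; apply: eq_bigr => j /BB' ->.
Qed.

Lemma independent_of_bigcup (F : nat -> set Omega) J : trivIset setT F ->
  (forall k, independent_of (F k) J) -> independent_of (\bigcup_k F k) J.
Proof.
move=> tF hF; have mF k : measurable (F k) by case: (hF k).
have mU : measurable (\bigcup_k F k) by exact: bigcup_measurable.
split=> // s B us sJ.
rewrite setI_bigcupl !measure_semi_bigcup//.
- rewrite muleC -[P (cylinder s B)]fineK; last first.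
    by rewrite fin_num_measure//; exact: measurable_cylinder.
  rewrite -nneseriesZl//; apply: eq_eseriesr => k _.
  rewrite fineK; last by rewrite fin_num_measure//; exact: measurable_cylinder.
  by rewrite muleC; exact: (hF k).2.
- by move=> k; apply: measurableI => //; exact: measurable_cylinder.
- by apply: trivIset_setIr.
- by rewrite -setI_bigcupl; apply: measurableI => //; exact: measurable_cylinder.
Qed.

(* Indices of the variables that are still unused once the first [m]
   generations and the first [r] offspring numbers of generation m+1 are known *)
Definition unused m r : set index :=
  [set i | (0 < i.2)%N /\ ((m.+1 < i.1)%N \/ i.1 = m.+1 /\ (r < i.2)%N)].

Lemma unused_valid m r : unused m r `<=` valid_index.
Proof. by move=> [a b] [/= b0 [a0|[-> _]]]; split => //=; exact: leq_trans a0. Qed.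

Definition partial_gen m r (w : Omega) : Ndelta :=
  \big[addD/state 0]_(1 <= j < r.+1) X m.+1 j w.

Lemma partial_gen0 m w : partial_gen m 0 w = state 0.
Proof. by rewrite /partial_gen big_geq. Qed.

Lemma partial_genS m r w :
  partial_gen m r.+1 w = addD (partial_gen m r w) (X m.+1 r.+1 w).
Proof. by rewrite /partial_gen big_nat_recr. Qed.

(** The event is split by the value [l] of the previous partial sum; each piece absorbs one more
    offspring variable. *)
Lemma independent_partial_gen E m r k : independent_of E (unused m 0) ->
  independent_of (E `&` partial_gen m r @^-1` [set state k]) (unused m r).
Proof.
move=> hE; elim: r k => [|r IH] k.
  case: k => [|k].
    rewrite (_ : _ `&` _ = E)//; apply/seteqP; split => [w []//|w Ew].
    by split => //=; rewrite partial_gen0.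
  rewrite (_ : _ `&` _ = set0); first exact: independent_of_set0.
  by apply/seteqP; split => [w [_ /=]|w []//]; rewrite partial_gen0.
have -> : E `&` partial_gen m r.+1 @^-1` [set state k] = \bigcup_l
    ((E `&` partial_gen m r @^-1` [set state l]) `&`
     X m.+1 r.+1 @^-1` [set x | addD (state l) x = state k]).
  apply/seteqP; split => [w [Ew /=]|w [l _ [[Ew /= h1] /= h2]]].
    rewrite partial_genS; case h : (partial_gen m r w) => [l|]//= hk.
    by exists l.
  by split => //=; rewrite partial_genS h1.
apply: independent_of_bigcup.
  move=> i j _ _ [w [[[_ /= hi] _] [[_ /= hj] _]]].
  by move: hj; rewrite hi => -[].
move=> l; have [] := @independent_of_preimage _ (unused m r) (m.+1, r.+1)
  [set x | addD (state l) x = state k] (@unused_valid m r) _ (IH l).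
  by split => //=; right.
move=> _; apply: independent_of_sub => i [i2 [i1|[i1 ri]]].
  by split; [split => //; left|move=> /= e; rewrite e /= ltnn in i1].
split; first by split => //; right; split => //; exact: ltnW.
by move=> /= e; rewrite e /= ltnn in ri.
Qed.

(** On Z_m = z the next generation is [partial_gen m z], a sum of fixed length, so the previous
    lemma applies to each piece. *)
Lemma independent_GW m k :
  independent_of (GW (fun n j => X n j) m @^-1` [set state k]) (unused m 0).
Proof.
elim: m k => [|m IH] k.
  case: k => [|[|k]].
  - rewrite (_ : _ @^-1` _ = set0); first exact: independent_of_set0.
    by apply/seteqP; split.
  - rewrite (_ : _ @^-1` _ = setT); first exact: independent_of_setT.
    by apply/seteqP; split.
  - rewrite (_ : _ @^-1` _ = set0); first exact: independent_of_set0.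
    by apply/seteqP; split.
have -> : GW (fun n j => X n j) m.+1 @^-1` [set state k] = \bigcup_z
    (GW (fun n j => X n j) m @^-1` [set state z] `&`
      partial_gen m z @^-1` [set state k]).
  apply/seteqP; split => [w /=|w [z _ [/= -> //]]].
  by case h : (GW _ m w) => [z|]//= hk; exists z.
apply: independent_of_bigcup.
  move=> i j _ _ [w [[/= hi _] [/= hj _]]].
  by move: hj; rewrite hi => -[].
move=> z; apply: independent_of_sub (independent_partial_gen z k (IH z)).
move=> i [i2 h]; split => //; left.
by case: h => [|[-> _]]//; exact: ltnW.
Qed.

Lemma measurable_partial_gen m r : measurable_fun setT (partial_gen m r).
Proof.
apply: measurable_fun_Ndelta => k.
have [] := independent_partial_gen r k (independent_of_setT (unused m 0)).
by rewrite setTI.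
Qed.

Lemma measurable_GW m : measurable_fun setT (GW (fun n j => X n j) m).
Proof. by apply: measurable_fun_Ndelta => k; case: (independent_GW m k). Qed.

(** The value 0 at Delta excludes Delta from expectations and keeps [power s] multiplicative for
    [addD]. *)
Definition power (s : R) (x : Ndelta) : \bar R :=
  if x is Some k then (s ^+ k)%:E else 0.

Lemma power_ge0 (t : R) x : (0 <= t)%R -> 0 <= power t x.
Proof. by case: x => [k|] t0 //=; rewrite lee_fin exprn_ge0. Qed.

Lemma measurable_power (t : R) (Y : Omega -> Ndelta) : measurable_fun setT Y ->
  measurable_fun setT (fun w => power t (Y w)).
Proof.
move=> mY; apply: (measurableT_comp (f := power t)) => //.
Qed.

Lemma power_addD (t : R) x y : power t (addD x y) = power t x * power t y.
Proof.
by case: x y => [k|] [l|]//=; rewrite ?mul0e ?mule0// exprD EFinM.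
Qed.

Lemma offspring_ge0 n k : (0 <= f n.+1 k)%R.
Proof.
by case: hX => _ h _; rewrite -lee_fin -(h n.+1 1%N k).
Qed.

(** The event [E] is arbitrary because the induction on [r] conditions on the last variable and
    absorbs its value into [E]. *)
Lemma integral_power_partial_gen E m r (s phi : R) : (0 <= s)%R ->
  genfun (f m.+1) s = phi%:E ->
  independent_of E [set i | i.1 = m.+1 /\ (0 < i.2 <= r)%N] ->
  \int[P]_(w in E) power s (partial_gen m r w) = P E * (phi ^+ r)%:E.
Proof.
move=> s0 hphi; elim: r E => [|r IH] E hE.
  have mE : measurable E by case: hE.
  under eq_integral do rewrite partial_gen0 /= expr0.
  by rewrite integral_cst// expr0 mule1 mul1e.
have mE : measurable E by case: hE.
have mS := measurable_partial_gen m r.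
rewrite (integral_Ndelta _ (Y := X m.+1 r.+1)) //; last 3 first.
- exact/measurable_power/measurable_partial_gen.
- by move=> w; exact: power_ge0.
- by move=> w e; rewrite partial_genS e; case: (partial_gen m r w).
transitivity (\sum_(0 <= k <oo) (P E * (phi ^+ r)%:E) * (f m.+1 k * s ^+ k)%:E).
  apply: eq_eseriesr => k _.
  have sub : [set i : index | i.1 = m.+1 /\ (0 < i.2 <= r.+1)%N] `<=` valid_index.
    by move=> [a b] [/= -> /andP[]].
  have [|PEX hEX] := @independent_of_preimage E _ (m.+1, r.+1) [set state k]
    sub _ hE; first by split => //=; rewrite leqnn.
  rewrite /= in PEX hEX.
  transitivity (\int[P]_(w in E `&` X m.+1 r.+1 @^-1` [set state k])
      ((s ^+ k)%:E * power s (partial_gen m r w))).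
    apply: eq_integral => w; rewrite inE => -[_ /= e].
    by rewrite partial_genS e power_addD muleC.
  rewrite ge0_integralZl_EFin ?exprn_ge0//; last 3 first.
  - by apply: measurableI => //; exact: measurable_X.
  - by move=> w _; exact: power_ge0.
  - by apply: measurable_funTS; exact: measurable_power.
  rewrite IH; last first.
    apply: independent_of_sub hEX => -[a b] [/= -> /andP[b0 br]]; split.
      by split => //=; rewrite b0 leqW.
    by move=> [br']; rewrite br' ltnn in br.
  have XE : P (X m.+1 r.+1 @^-1` [set state k]) = (f m.+1 k)%:E.
    by case: hX => _ -> //.
  rewrite PEX XE EFinM muleCA -!muleA; congr (_ * _).
  by rewrite -!EFinM; congr (_%:E); ring.
have PE : P E = (fine (P E))%:E by rewrite fineK// fin_num_measure.
rewrite PE -EFinM nneseriesZl; last first.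
  by move=> k _; rewrite lee_fin mulr_ge0 ?exprn_ge0// offspring_ge0.
by rewrite -/(genfun (f m.+1) s) hphi -!EFinM exprSr mulrA.
Qed.

(** Conditioning on Z_n replaces [power s] of Z_(n+1) by [power (G n.+1 s)] of Z_n, hence the
    induction for all [s] at once. *)
Lemma integral_power_GW n (G : nat -> R -> R) (s : R) :
  (forall k, unit_interval_map (G k.+1)) ->
  (forall k t, (0 <= t)%R -> (t <= 1)%R -> genfun (f k.+1) t = (G k.+1 t)%:E) ->
  (0 <= s)%R -> (s <= 1)%R ->
  \int[P]_w power s (GW (fun n j => X n j) n w) = (iterG G 0 n s)%:E.
Proof.
move=> G01 hG; elim: n s => [|n IH] s s0 s1.
  under eq_integral do rewrite /= expr1.
  by rewrite integral_cst// -[RHS]mule1; congr (_ * _); exact: probability_setT.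
have /andP[G0 G1] : (0 <= G n.+1 s <= 1)%R by apply: G01; rewrite s0.
rewrite iterG_last -IH//.
have mGW m := measurable_GW m.
rewrite [LHS](integral_Ndelta P (Y := GW (fun n j => X n j) n))//; last 3 first.
- exact: measurable_power.
- by move=> w; exact: power_ge0.
- by move=> w /= ->.
rewrite [RHS](integral_Ndelta P (Y := GW (fun n j => X n j) n))//; last 3 first.
- exact: measurable_power.
- by move=> w; exact: power_ge0.
- by move=> w ->.
apply: eq_eseriesr => z _; rewrite setTI.
have hz := independent_GW n z.
transitivity (\int[P]_(w in GW (fun n j => X n j) n @^-1` [set state z])
    power s (partial_gen n z w)).
  by apply: eq_integral => w; rewrite inE /= => ->.
rewrite (integral_power_partial_gen s0 (hG n s s0 s1)); last first.
  by apply: independent_of_sub hz => -[a b] [/= -> /andP[b0 _]]; split => //; right.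
under [RHS]eq_integral => w.
  rewrite inE /= => -> /=; over.
by rewrite integral_cst 1?muleC//; case: hz.
Qed.

(** At s = 1 the function [power] is the indicator of not being Delta, at s = 0 that of [state 0],
    as 0^0 = 1. *)
Lemma prob_alive n (G : nat -> R -> R) :
  (forall k, unit_interval_map (G k.+1)) ->
  (forall k t, (0 <= t)%R -> (t <= 1)%R -> genfun (f k.+1) t = (G k.+1 t)%:E) ->
  P [set w | exists k, GW (fun n j => X n j) n w = state k.+1] = (alive G 0 n)%:E.
Proof.
move=> G01 hG.
set Z := GW _ n; have mZ : measurable_fun setT Z := measurable_GW n.
have mpre A : measurable (Z @^-1` A) by rewrite -[_ @^-1` _]setTI; exact: mZ.
have P1 : P (Z @^-1` [set~ Delta]) = (iterG G 0 n 1)%:E.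
  rewrite -(integral_power_GW n G01 hG)// -(setIT (Z @^-1` _)) -integral_indic//.
  apply: eq_integral => w _; rewrite indicE -/Z.
  case e : (Z w) => [k|]; rewrite /= ?expr1n.
    by rewrite mem_set//= e.
  by rewrite memNset//= e; apply.
have P0 : P (Z @^-1` [set state 0]) = (iterG G 0 n 0)%:E.
  rewrite -(integral_power_GW n G01 hG)// -(setIT (Z @^-1` _)) -integral_indic//.
  apply: eq_integral => w _; rewrite indicE -/Z.
  case e : (Z w) => [[|k]|]; rewrite /= ?expr0 ?expr0n.
  - by rewrite mem_set//= e.
  - by rewrite memNset//= e.
  - by rewrite memNset//= e.
have mA : measurable [set w | exists k, Z w = state k.+1].
  rewrite (_ : [set w | _] = Z @^-1` [set x | exists k, x = state k.+1])//.
rewrite /alive EFinB -P1 -P0.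
rewrite (_ : Z @^-1` [set~ Delta] =
  [set w | exists k, Z w = state k.+1] `|` Z @^-1` [set state 0]); last first.
  apply/seteqP; split => w /=; last by case=> [[k ->]|->].
  by case: (Z w) => [[|k]|]// _; [right|left; exists k].
rewrite [X in _ = X - _]measureU//; last first.
  by rewrite -subset0 => w [/= [k ->]].
rewrite [RHS]addeK// fin_num_measure//.
Qed.

End offspring.

(** * Survival *)

Section real_translation.
Context {R : realType}.
Implicit Types (a : nat -> R).

Lemma nneseries_window a : (forall n, (0 <= a n.+1)%R) ->
  \sum_(1 <= n <oo) (a n)%:E < +oo <->
  exists A, forall n, (window a 0 n <= A)%R.
Proof.
move=> a0; have a0' n : (1 <= n)%N -> xpredT n -> 0 <= (a n)%:E.
  by case: n => // n _ _; rewrite lee_fin.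
split=> [afin|[A hA]].
  have S0 : 0 <= \sum_(1 <= n <oo) (a n)%:E by exact: nneseries_ge0.
  exists (fine (\sum_(1 <= n <oo) (a n)%:E)) => n.
  rewrite -lee_fin fineK ?ge0_fin_numE// /window add0n -sumEFin.
  exact: nneseries_lim_ge.
apply: (@le_lt_trans _ _ A%:E); last exact: ltry.
apply: lime_le; first exact: is_cvg_nneseries.
apply: nearW => -[|n].
  by rewrite big_geq// lee_fin (le_trans _ (hA 0%N))// window0.
by rewrite sumEFin lee_fin; have := hA n; rewrite /window add0n.
Qed.

Lemma ereal_inf_gt0 a : (0 < a 0%N)%R ->
  0 < ereal_inf [set (a n)%:E | n in [set n | (0 < n)%N]] <->
  exists2 e, (0 < e)%R & forall n, (e <= a n)%R.
Proof.
move=> a00; split=> [|[e e0 he]].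
  set I := ereal_inf _ => I0.
  have Ile n : (0 < n)%N -> I <= (a n)%:E.
    by move=> n0; apply: ereal_inf_lbound; exists n.
  have Ifin : I \is a fin_num.
    by rewrite ge0_fin_numE ?(ltW I0)// (le_lt_trans (Ile 1%N isT))// ltry.
  (* The infimum starts at n = 1, so the bound at n = 0 is added by hand. *)
  exists (Num.min (fine I) (a 0%N)).
    by rewrite lt_min a00 andbT fine_gt0// I0/= -ge0_fin_numE ?(ltW I0).
  case=> [|n]; first by rewrite ge_min lexx orbT.
  by rewrite ge_min -lee_fin fineK// Ile.
apply: (@lt_le_trans _ _ e%:E); first by rewrite lte_fin.
by apply/ereal_infP => _ [n _ <-]; rewrite lee_fin.
Qed.

End real_translation.

(** * Survival as the decreasing limit of the events of being alive *)

Section absorption.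
Context {d : measure_display} {Omega : measurableType d} {R : realType}.
Variables (P : probability Omega R) (X : nat -> nat -> Omega -> Ndelta).

Definition alive_event n : set Omega :=
  [set w | exists k, GW X n w = state k.+1].

Lemma hitting_time_pinfty (Z : nat -> Omega -> Ndelta) x w :
  hitting_time (R := R) Z x w = +oo <-> forall n, (0 < n)%N -> Z n w <> x.
Proof.
split=> [h n n0 Zn|h].
  have : hitting_time (R := R) Z x w <= n%:R%:E.
    by apply: ereal_inf_lbound; exists n.
  by rewrite h leye_eq.
rewrite /hitting_time (_ : [set _ | _ in _] = set0) ?ereal_inf0//.
by rewrite -subset0 => y [n [n0 e] _]; exact: (h n n0 e).
Qed.

Lemma absorption_time_pinfty w :
  absorption_time (R := R) (GW X) w = +oo <-> forall n, alive_event n w.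
Proof.
have -> : absorption_time (R := R) (GW X) w = +oo <->
    hitting_time (R := R) (GW X) (state 0) w = +oo /\
    hitting_time (R := R) (GW X) Delta w = +oo.
  rewrite /absorption_time; split=> [h|[-> ->]]; last by rewrite minxx.
  by split; apply/eqP; rewrite -leye_eq -h ge_min lexx ?orbT.
rewrite !hitting_time_pinfty; split=> [[h0 hD] [|n]|h].
- by exists 0%N.
- by case e : (GW X n.+1 w) (h0 n.+1 isT) (hD n.+1 isT) => [[|k]|]// _ _; exists k.
- by split=> n _ e; have [k] := h n; rewrite e.
Qed.

Lemma alive_event_nonincreasing n : alive_event n.+1 `<=` alive_event n.
Proof.
move=> w [k]; rewrite /alive_event /=.
by case: (GW X n w) => [[|z]|]//=; [rewrite big_geq|exists z].
Qed.

Hypothesis measurable_alive : forall n, measurable (alive_event n).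

Lemma survival_cvg :
  P (alive_event n) @[n --> \oo] -->
  P [set w | absorption_time (R := R) (GW X) w = +oo].
Proof.
have -> : [set w | absorption_time (R := R) (GW X) w = +oo] =
    \bigcap_n alive_event n.
  apply/seteqP; split=> [w /absorption_time_pinfty h n _//|w h].
  by apply/absorption_time_pinfty => n; exact: h.
apply: nonincreasing_cvg_mu => //.
- by rewrite -ge0_fin_numE// fin_num_measure.
- exact: bigcap_measurable.
- apply/nonincreasing_seqP => n; apply/subsetPset.
  exact: alive_event_nonincreasing.
Qed.

Lemma survival_le n :
  P [set w | absorption_time (R := R) (GW X) w = +oo] <= P (alive_event n).
Proof.
apply: le_measure; rewrite ?inE//; last first.
  by move=> w /absorption_time_pinfty; apply.
rewrite (_ : [set w | _] = \bigcap_n alive_event n).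
  exact: bigcap_measurable.
apply/seteqP; split=> [w /absorption_time_pinfty h m _//|w h].
by apply/absorption_time_pinfty => m; exact: h.
Qed.

Lemma survival_gt0_alive (a : nat -> R) :
  (forall n, P (alive_event n) = (a n)%:E) ->
  0 < P [set w | absorption_time (R := R) (GW X) w = +oo] ->
  exists2 q, (0 < q)%R & forall n, (q <= a n)%R.
Proof.
move=> Pa; set S := P _ => S0.
have Sfin : S \is a fin_num.
  by rewrite ge0_fin_numE ?(ltW S0)// (le_lt_trans (survival_le 0%N))// Pa ltry.
exists (fine S); first by rewrite fine_gt0// S0/= -ge0_fin_numE ?(ltW S0).
by move=> n; rewrite -lee_fin fineK// -Pa survival_le.
Qed.

Lemma alive_survival_gt0 (a : nat -> R) :
  (forall n, P (alive_event n) = (a n)%:E) ->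
  (exists2 q, (0 < q)%R & exists k, forall l, (q <= a (k + l)%N)%R) ->
  0 < P [set w | absorption_time (R := R) (GW X) w = +oo].
Proof.
move=> Pa [q q0 [k hk]].
apply: (@lt_le_trans _ _ q%:E); first by rewrite lte_fin.
rewrite -(cvg_lim _ survival_cvg)//; apply: lime_ge.
  by apply: cvgP; exact: survival_cvg.
by exists k => // n /= kn; rewrite Pa lee_fin -(subnKC kn).
Qed.

End absorption.

(** * Identifying the extended-real moments with real ones *)

Section weights_ereal.
Context {R : realType}.
Variable g : nat -> R.
Hypothesis g_ge0 : forall k, (0 <= g k)%R.
Hypothesis g_sum : \sum_(0 <= k <oo) (g k)%:E <= 1.
Hypothesis moment1 : 0 < fact_moment1 g < +oo.

Lemma nneseries_le_fin (h h' : nat -> R) : (forall k, (0 <= h k <= h' k)%R) ->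
  \sum_(0 <= k <oo) (g k * h' k)%:E < +oo ->
  \sum_(0 <= k <oo) (g k * h k)%:E < +oo.
Proof.
move=> hh'; apply: le_lt_trans; apply: lee_nneseries => k _.
  by rewrite lee_fin mulr_ge0//; have /andP[] := hh' k.
by rewrite lee_fin ler_wpM2l//; have /andP[] := hh' k.
Qed.

Lemma one_fin : \sum_(0 <= k <oo) (g k * 1)%:E < +oo.
Proof.
apply: le_lt_trans (ltry 1); apply: le_trans g_sum.
by under eq_eseriesr do rewrite mulr1.
Qed.

Lemma fact_moment1E :
  cvgn (series (weighted g (fun k => k%:R))) /\ fact_moment1 g = (mean g)%:E.
Proof.
have e : fact_moment1 g = \sum_(0 <= k <oo) (g k * k%:R)%:E.
  by apply: eq_eseriesr => k _; rewrite mulrC.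
by rewrite e; apply: EFin_wsum => //; rewrite -e; case/andP: moment1.
Qed.

Lemma mean_gt0 : (0 < mean g)%R.
Proof. by case/andP: moment1; rewrite fact_moment1E.2 lte_fin. Qed.

Lemma genfunE (s : R) : (0 <= s)%R -> (s <= 1)%R -> genfun g s = (pgf g s)%:E.
Proof.
move=> s0 s1; apply: (EFin_wsum g_ge0 _ _).2 => [k|]; first exact: exprn_ge0.
by apply: nneseries_le_fin one_fin => k; rewrite exprn_ge0 ?exprn_ile1.
Qed.

Lemma pgf1_le1 : (pgf g 1 <= 1)%R.
Proof.
rewrite -lee_fin -genfunE// /genfun.
by under eq_eseriesr do rewrite expr1n mulr1.
Qed.

Let sqR : nat -> R := fun k => (k%:R ^+ 2)%R.

Lemma fact_moment2E : \sum_(0 <= k <oo) (g k * at_least 2 sqR k)%:E < +oo ->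
  fact_moment2 g = (fact2 g)%:E.
Proof.
move=> sfin; rewrite /fact_moment2.
under eq_eseriesr do rewrite mulrC.
apply: (EFin_wsum g_ge0 _ _).2 => [k|].
  by case: k => [|k]; rewrite ?mul0r// mulr_ge0// subr_ge0 ler1n.
apply: nneseries_le_fin sfin => k.
case: k => [|[|k]]; rewrite /at_least /sqR ?mul0r ?subrr ?mulr0 ?lexx//=.
by rewrite mul1r mulr_ge0 ?subr_ge0 ?ler1n//= expr2 ler_wpM2l// gerBl.
Qed.

End weights_ereal.

Section offspring_moments.
Context {d : measure_display} {Omega : measurableType d} {R : realType}.
Variables (P : probability Omega R) (f : nat -> nat -> R).
Variable X : nat -> nat -> {RV P >-> Ndelta}.
Hypothesis hX : offspring_array f X.

Lemma expect_on_at_least n (h : nat -> R) a : (forall k, (0 <= h k)%R) ->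
  expect_on P (X n.+1 1) h [set k | (a <= k)%N] =
  \sum_(0 <= k <oo) (f n.+1 k * at_least a h k)%:E.
Proof.
move=> h0; set Y : Omega -> Ndelta := X n.+1 1%N.
have mY : measurable_fun setT Y by exact: measurable_funPT.
have mpre A : measurable (Y @^-1` A) by rewrite -[_ @^-1` _]setTI; exact: mY.
pose H (x : Ndelta) : \bar R := if x is Some k then (h k)%:E else 0.
have H0 x : 0 <= H x by case: x => [k|] //=; rewrite lee_fin.
have -> : expect_on P Y h [set k | (a <= k)%N] =
    \int[P]_(w in Y @^-1` [set x | exists2 k, (a <= k)%N & x = state k]) H (Y w).
  by apply: eq_integral => w; rewrite inE => -[k _ e]; rewrite e.
rewrite (integral_Ndelta P (Y := Y))//; last 2 first.
- by apply: (measurableT_comp (f := H)).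
- by move=> w ->.
apply: eq_eseriesr => k _; rewrite /at_least.
have [ak|ka] := leqP a k; last first.
  rewrite mul0r mulr0 (_ : _ `&` _ = set0) ?integral_set0//.
  rewrite -subset0 => w [/= [l al ->] [lk]].
  by rewrite -lk ltnNge al in ka.
rewrite mul1r (_ : _ `&` _ = Y @^-1` [set state k]); last first.
  by apply/seteqP; split => [w []//|w /= ->]; split => //=; exists k.
under eq_integral => w.
  rewrite inE /= => -> /=; over.
rewrite integral_cst// muleC mulrC EFinM muleC; congr (_ * _).
by case: hX => _ + _; apply.
Qed.

End offspring_moments.

Section environment_regularity.
Context {d : measure_display} {Omega : measurableType d} {R : realType}.
Variables (P : probability Omega R) (f : nat -> nat -> R).
Variable X : nat -> nat -> {RV P >-> Ndelta}.
Hypothesis hf : varying_environment f.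
Hypothesis hX : offspring_array f X.

(** Besides the bound itself, the assumption provides a finite second moment, since its right-hand
    side is finite. *)
Lemma environment_regular n c : (0 < c)%R ->
  expect_on P (X n.+1 1%N) (fun k => (k%:R ^+ 2)%R) [set k | (2 <= k)%N]
    <= c%:E * expect_on P (X n.+1 1%N) (fun k => k%:R%R) [set k | (2 <= k)%N]
           * cond_expect P (X n.+1 1%N) (fun k => k%:R%R) [set k | (1 <= k)%N] ->
  fact_moment2 (f n.+1) = (fact2 (f n.+1))%:E /\
  offspring_map (4 * c)^-1 (pgf (f n.+1)) (mean (f n.+1)) (fact2 (f n.+1)).
Proof.
move=> c0; have [[g0 gsum] gm] := hf (ltn0Sn n).
set g := f n.+1 in g0 gsum gm *.
have [cvg_id m1E] := fact_moment1E g0 gm.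
have [cvg_one _] := EFin_wsum g0 (fun k => ler01) (one_fin gsum).
have m0 : (0 < mean g)%R := mean_gt0 g0 gm.
have P0 : (0 < wsum g (at_least 1 (fun=> 1%R)))%R by exact: pos_gt0.
have id0 k : (0 <= k%:R :> R)%R by [].
have at0 a h k : (forall k, (0 <= h k :> R)%R) -> (0 <= at_least a h k)%R.
  by move=> h0; rewrite mulr_ge0.
have id_fin : \sum_(0 <= k <oo) (g k * k%:R)%:E < +oo.
  by under eq_eseriesr do rewrite mulrC; case/andP: gm.
have T_fin : \sum_(0 <= k <oo) (g k * at_least 2 (fun k => k%:R%R) k)%:E < +oo.
  apply: (nneseries_le_fin g0 _ id_fin) => k; rewrite at0//=.
  by rewrite -[leRHS]mul1r ler_wpM2r// lern1 leq_b1.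
have one_at_fin : \sum_(0 <= k <oo) (g k * at_least 1 (fun=> 1%R) k)%:E < +oo.
  apply: (nneseries_le_fin g0 _ (one_fin gsum)) => k; rewrite at0//=.
  by rewrite /at_least mulr1 lern1 leq_b1.
rewrite /cond_expect !(expect_on_at_least hX)//.
have -> : P (event_in (X n.+1 1%N) [set k | (1 <= k)%N]) =
    (wsum g (at_least 1 (fun=> 1%R)))%:E.
  rewrite -(EFin_wsum g0 (fun k => at0 1%N _ k (fun=> ler01)) one_at_fin).2.
  rewrite -(expect_on_at_least hX)// /expect_on integral_cst ?mul1e//.
  rewrite (_ : event_in _ _ =
    X n.+1 1%N @^-1` [set x | exists2 k, (1 <= k)%N & x = state k])//.
  exact: measurable_X.
rewrite (EFin_wsum g0 (fun k => at0 2%N _ k id0) T_fin).2.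
(* The term k = 0 vanishes, so the numerator of the conditional mean is the full mean. *)
have -> : \sum_(0 <= k <oo) (g k * at_least 1 (fun k => k%:R%R) k)%:E = (mean g)%:E.
  rewrite -m1E; apply: eq_eseriesr => k _; rewrite mulrC /at_least.
  by case: k => [|k]; rewrite ?mul0r// mul1r.
rewrite inver gt_eqF// -!EFinM => hc.
have S_fin := le_lt_trans hc (ltry _).
split; first exact: fact_moment2E.
have [cvg_sq sqE] := EFin_wsum g0 (fun k => at0 2%N _ k (fun k => sqr_ge0 _)) S_fin.
apply: pgf_offspring_map => //; first exact: pgf1_le1.
move: hc; rewrite sqE lee_fin => hc.
by rewrite -ler_pdivlMr// mulrA in hc *.
Qed.

End environment_regularity.

(** * The three conditions in real terms, and both implications *)

Unset Implicit Arguments.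

Theorem theorem2 (R : realType) (d : measure_display)
    (Omega : measurableType d) (P : probability Omega R)
    (f : nat -> nat -> R) (X : nat -> nat -> {RV P >-> Ndelta})
    (hf : varying_environment f) (hX : offspring_array f X)
    (hc : exists c : R, (0 < c)%R /\ forall n : nat, (0 < n)%N ->
       expect_on P (X n 1%N) (fun k => (k%:R ^+ 2)%R) [set k | (2 <= k)%N]
       <= c%:E * expect_on P (X n 1%N) (fun k => k%:R%R) [set k | (2 <= k)%N]
              * cond_expect P (X n 1%N) (fun k => k%:R%R) [set k | (1 <= k)%N]) :
  0 < P [set w | absorption_time (R := R) (GW (fun n j => X n j)) w = +oo]
  <->
  [/\ 0 < ereal_inf [set mu f n | n in [set n | (0 < n)%N]],
      \sum_(1 <= n <oo) defect f n * mu f n.-1 < +oo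
    & \sum_(1 <= n <oo)
        fact_moment2 (f n) / (fact_moment1 (f n) * mu f n) < +oo].
Proof.
have [c [c0 {}hc]] := hc.
pose G n := pgf (f n); pose m n := mean (f n); pose b n := fact2 (f n).
have hreg n := environment_regular hf hX c0 (hc n.+1 isT).
have hG n : offspring_map (4 * c)^-1 (G n.+1) (m n.+1) (b n.+1) := (hreg n).2.
have k0 : (0 < (4 * c)^-1)%R by rewrite invr_gt0 mulr_gt0.
have G01 n : unit_interval_map (G n.+1) := om_unit (hG n).
have genE n t : (0 <= t)%R -> (t <= 1)%R -> genfun (f n.+1) t = (G n.+1 t)%:E.
  by have [[g0 gsum] _] := hf n.+1 isT; exact: genfunE.
have m1E n : fact_moment1 (f n.+1) = (m n.+1)%:E.
  by have [[g0 _] gm] := hf n.+1 isT; exact: (fact_moment1E g0 gm).2.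
have muE n : mu f n = (meanprod m n)%:E.
  elim: n => [|n IH]; first by rewrite /mu meanprod0 big_geq.
  by rewrite meanprodS EFinM -IH -m1E /mu big_nat_recr.
have killE : \sum_(1 <= n <oo) defect f n * mu f n.-1 =
    \sum_(1 <= n <oo) (killing G m n)%:E.
  (* The lower summation bound becomes a condition, which discards index 0, where [f] is
     unconstrained. *)
  rewrite eseries_cond [RHS]eseries_cond; apply: eq_eseriesr => -[//|n] _.
  by rewrite /defect genE// muE -EFinB -EFinM.
have M0 n : (0 < meanprod m n)%R := meanprod_gt0 hG n.
have rhoE : \sum_(1 <= n <oo) fact_moment2 (f n) / (fact_moment1 (f n) * mu f n) =
    \sum_(1 <= n <oo) (rho m b n)%:E.
  rewrite eseries_cond [RHS]eseries_cond; apply: eq_eseriesr => -[//|n] _.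
  rewrite (hreg n).1 m1E muE -EFinM inver gt_eqF ?mulr_gt0//.
  exact: om_mean_gt0 (hG n).
have malive n : measurable (alive_event (fun n j => X n j) n).
  have mZ := measurable_GW hX n.
  rewrite (_ : alive_event _ n =
    setT `&` GW (fun n j => X n j) n @^-1` [set x | exists k, x = state k.+1]).
    exact: mZ.
  by rewrite setTI.
have Palive n := prob_alive hX n G01 genE.
rewrite killE rhoE.
have hkill := nneseries_window (killing_ge0 hG).
have hrho := nneseries_window (rho_ge0 hG).
have hmu : 0 < ereal_inf [set mu f n | n in [set n | (0 < n)%N]] <->
    exists2 e, (0 < e)%R & forall n, (e <= meanprod m n)%R.
  under eq_imagel do rewrite muE.
  exact: ereal_inf_gt0.
split=> [/(survival_gt0_alive malive Palive)[q q0 hq]|].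
  split.
  - apply/hmu; exists q => // n; apply: le_trans (hq n) _.
    exact: (alive_le_meanprod k0 hG).
  - apply/hkill; exact: (window_killing_bounded k0 hG q0 hq).
  - apply/hrho; exists (q * (4 * c)^-1)^-1%R => n.
    exact: (window_rho_bounded k0 hG q0 hq).
case=> /hmu[e e0 he] /hkill[A hA] /hrho[B hB].
apply: (alive_survival_gt0 malive Palive).
exact: (alive_lower hG e0 he hA hB).
Qed.
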